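(* Let $n\ge 2$ and let $A=(a_{ij})_{i,j=1}^n$ be a real symmetric matrix with $\mathrm{tr}(A)=0$. Let $g(x)=\sum_{i,j}a_{ij}x_ix_j$ and let $f=Cg$, where the constant $C$ is chosen so that $\|f\|_2=1$ when $f$ is regarded as a function on $S^{n-1}$ (i.e. $\mathbb{E}f(X)^2=1$ for $X$ uniform on $S^{n-1}$). Let $W=f(X)$ where $X$ is a uniformly random point of $S^{n-1}$, and let $Z$ be a standard Gaussian random variable. If $d\in\mathbb{R}^n$ is the vector whose entries are the eigenvalues of $A$, then $$d_{TV}(W,Z)\le\sqrt{6}\left(\frac{\|d\|_4}{\|d\|_2}\right)^2,$$ where $\|d\|_p=\left(\sum_i|d_i|^p\right)^{1/p}$.
   Context: $S^{n-1}\subseteq\mathbb{R}^n$ is the unit sphere with uniform (normalized surface) probability measure. For real random variables, $d_{TV}(X,Y)=\sup_A|\mathbb{P}(X\in A)-\mathbb{P}(Y\in A)|$ over measurable sets $A$. *)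

(* Defs.v *)
From HB Require Import structures.
From mathcomp Require Import all_boot all_order all_algebra.
From mathcomp Require Import all_classical all_reals all_analysis.
Set Implicit Arguments. Unset Strict Implicit. Unset Printing Implicit Defensive.
Import Order.TTheory GRing.Theory Num.Theory.
Local Open Scope classical_set_scope.
Local Open Scope ring_scope.

Section Defs.
Context {R : realType}.

Definition enorm n (x : 'rV[R]_n) : R := Num.sqrt (\sum_(i < n) x 0 i ^+ 2).

(* Iterated Lebesgue integral over R^n of a (nonnegative) extended-real
   function: int_{R^0} h = h(), int_{R^(n+1)} h = int_R (int_{R^n} h(x,.)) dx.
   For measurable nonnegative h this is the integral against n-dimensional
   Lebesgue measure (Tonelli). *)
Fixpoint iint (n : nat) : ('rV[R]_n -> \bar R) -> \bar R :=
  match n with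
  | 0 => fun h => h 0
  | k.+1 => fun h =>
      (\int[@lebesgue_measure R]_x
         iint (fun y : 'rV[R]_k => h (row_mx (const_mx x : 'rV[R]_1) y)))%E
  end.

Definition vol n (C : set 'rV[R]_n) : \bar R := iint (fun y => (\1_C y)%:E).

Definition punct_ball n : set 'rV[R]_n := [set y | 0 < enorm y <= 1].

(* Expectation E[phi(X)] of a nonnegative function phi : S^{n-1} -> R for
   X uniform on S^{n-1} (normalized surface measure), computed as the
   normalized cone measure:
     E phi(X) = (1/vol(B)) * int_B phi(y/|y|) dy. *)
Definition sphere_expect n (phi : 'rV[R]_n -> R) : \bar R :=
  (iint (fun y => (\1_(@punct_ball n) y * phi ((enorm y)^-1 *: y))%:E)
    * (fine (vol (@punct_ball n)))^-1%:E)%E.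

Definition sphere_prob n (E : set 'rV[R]_n) : \bar R :=
  sphere_expect (fun x => \1_E x).

Definition qform n (A : 'M[R]_n) (x : 'rV[R]_n) : R :=
  \sum_(i < n) \sum_(j < n) A i j * x 0 i * x 0 j.

Definition dTV_sphere_gauss n (f : 'rV[R]_n -> R) : \bar R :=
  ereal_sup [set `|(sphere_prob [set x | f x \in A] - normal_prob 0 1 A)%E|%E
            | A in [set A : set R | measurable A]].

Definition lpnorm n (p : R) (d : 'I_n -> R) : R :=
  powR (\sum_(i < n) powR `|d i| p) p^-1.

End Defs.

(* Main.v *)
Require Import Defs.
From HB Require Import structures.
From mathcomp Require Import all_boot all_order all_algebra.
From mathcomp Require Import all_classical all_reals all_analysis.
From mathcomp Require Import measurable_realfun ring lra.
Import Order.TTheory GRing.Theory Num.Theory numFieldNormedType.Exports.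
Local Open Scope classical_set_scope.
Local Open Scope ring_scope.

Set Implicit Arguments.
Unset Strict Implicit.
Unset Printing Implicit Defensive.

(** Write M = C A and q(x) = x M x^T, so that W = q(X) with tr M = 0 and
    E W^2 = 1. Integrating over R^n the divergence of the vector field
    (1 - |y|^2)_+ psi(q(y/|y|)) My, and separating the radial variable, gives
    for every C^1 function psi the identity
      n E[W psi(W)] = 2 E[psi'(W) (|MX|^2 - W^2)].
    The same identity with tr M <> 0, for psi = 1 and psi = id, yields the
    moments E|MX|^2 = tr M^2 / n and E|MX|^4, hence tr M^2 = n(n+2)/2.

    For h with values in [0,1] the solution of psi'(x) - x psi(x) = h(x) - E h(Z)
    satisfies |psi'| <= 1 (the oscillation of h enters, not twice its norm), so
    |E h(W) - E h(Z)| <= E|1 - T| with T = (2/n)(|MX|^2 - W^2). Since T has mean 1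
    and T <= T1 = (2/n)|MX|^2, E|1 - T| is controlled by E(T1 - 1)^2, that is by
    p = tr M^4 / (tr M^2)^2 = (|d|_4 / |d|_2)^4: it is at most sqrt(6 p) as soon as
    n >= 4, and for n <= 3 already sqrt(6 p) >= 1. This bound is first obtained for
    continuous h and then extended to indicators of Borel sets by approximation. *)

(** The uniform law of the sphere is the cone measure of the punctured ball, so all integrals are
    Lebesgue integrals over R^n and no surface measure is needed. The factor 1 - |y|^2 makes the
    field vanish on the boundary: the divergence theorem shrinks to the fundamental theorem of
    calculus on chords parallel to the axes. As the other factors depend on the direction of y, up
    to scaling, each term of the divergence is an angular function times |y|^2 or 1 - |y|^2. The
    averages of these two weights over the ball, n/(n+2) and 2/(n+2), are the source of the
    coefficients n and 2 of the identity. The field need not be smooth at 0, but 0 lies only on the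
    coordinate axes, where q(y/|y|) is constant off 0.

    Estimating E(T - 1)^2 directly would require E W^4 and E W^2 |MX|^2. Since E T = 1, only the
    positive part of T - 1 has to be bounded, and there T may be replaced by the larger T1, whose
    second moment comes from the identity applied to M^2. *)

(** * Pointwise rules for derivatives *)

Section is_derive_pointwise.
Variable R : realType.
Implicit Types (f g : R -> R) (x a b : R).

Lemma is_derive_mul f g x a b : is_derive x 1 f a -> is_derive x 1 g b ->
  is_derive x 1 (fun t => f t * g t) (a * g x + f x * b).
Proof.
move=> df dg; apply: (is_derive_eq (is_deriveM df dg)).
by rewrite /GRing.scale/= addrC (mulrC a).
Qed.

Lemma is_derive_add f g x a b : is_derive x 1 f a -> is_derive x 1 g b ->
  is_derive x 1 (fun t => f t + g t) (a + b).
Proof. by move=> df dg; exact: (is_deriveD df dg). Qed.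

Lemma is_derive_sub f g x a b : is_derive x 1 f a -> is_derive x 1 g b ->
  is_derive x 1 (fun t => f t - g t) (a - b).
Proof. by move=> df dg; exact: (is_deriveB df dg). Qed.

Lemma is_derive_const x b : is_derive x 1 (fun=> b) 0.
Proof. exact: is_derive_cst. Qed.

Lemma is_derive_ident x : is_derive x 1 (fun t : R => t) 1.
Proof. exact: is_derive_id. Qed.

Lemma is_derive_exp f x a n : is_derive x 1 f a ->
  is_derive x 1 (fun t => f t ^+ n) (n%:R * f x ^+ n.-1 * a).
Proof.
move=> df; rewrite (_ : (fun _ => _) = f ^+ n); first exact: is_deriveX.
by apply/funext => t; rewrite exprfctE.
Qed.

Lemma is_derive_invf f x a : f x != 0 -> is_derive x 1 f a ->
  is_derive x 1 (fun t => (f t)^-1) (- a / f x ^+ 2).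
Proof.
move=> fx df; apply: (is_derive_eq (is_deriveV fx df)).
by rewrite /GRing.scale/= !mulNr mulrC.
Qed.

Lemma is_derive_compf f g x a b : is_derive x 1 f a -> is_derive (f x) 1 g b ->
  is_derive x 1 (fun t => g (f t)) (b * a).
Proof. by move=> df dg; exact: is_derive1_comp. Qed.

Lemma is_derive_continuous f x a : is_derive x 1 f a -> {for x, continuous f}.
Proof.
move=> df; apply: differentiable_continuous; apply/derivable1_diffP.
exact: ex_derive.
Qed.

End is_derive_pointwise.

(** * Lebesgue measure on coordinate space *)

Section product_sigma_finite.
Context (R : realType) (d1 d2 : measure_display).
Context (T1 : measurableType d1) (T2 : measurableType d2).
Variable m1 : {sigma_finite_measure set T1 -> \bar R}.
Variable m2 : {sigma_finite_measure set T2 -> \bar R}.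

(* The library instance of sigma-finiteness on [m1 \x m2] is shadowed by the one
   for subprobabilities, hence the alias. *)
Definition sf_product : set (T1 * T2) -> \bar R := (m1 \x m2)%E.

HB.instance Definition _ := Measure.on sf_product.

Let sf_product_sigma_finite : sigma_finite setT sf_product.
Proof.
have /sigma_finiteP[F [F1 ndF F2]] := sigma_finiteT m1.
have /sigma_finiteP[G [G1 ndG G2]] := sigma_finiteT m2.
exists (fun k => F k `*` G k) => [|k]; last first.
  have [mF Foo] := F2 k; have [mG Goo] := G2 k.
  split; first exact: measurableX.
  by rewrite /sf_product product_measure1E// lte_mul_pinfty// ge0_fin_numE.
apply/esym/seteqP; split=> // -[x y] _.
have [i _ Fx] : (\bigcup_i F i) x by rewrite -F1.
have [j _ Gy] : (\bigcup_i G i) y by rewrite -G1.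
exists (maxn i j) => //; split => /=.
- by have /subsetPset := ndF _ _ (leq_maxl i j); apply.
- by have /subsetPset := ndG _ _ (leq_maxr i j); apply.
Qed.

HB.instance Definition _ := Measure_isSigmaFinite.Build _ _ _ sf_product
  sf_product_sigma_finite.

End product_sigma_finite.

Section coordinate_space.
Variable R : realType.

(** Bundling lets one recursion on [n] build carrier, sigma-algebra and measure together. The nested
    pairs of [leb] and the [row_mx] of [vec] follow the recursion of [iint] step by step. *)
Record sfspace := SFSpace {
  sfs_disp : measure_display;
  sfs_type : measurableType sfs_disp;
  sfs_mu : {sigma_finite_measure set sfs_type -> \bar R} }.

Definition sf_prod (d : measure_display) (T : measurableType d)
    (m : {sigma_finite_measure set T -> \bar R}) (S : sfspace) : sfspace :=
  SFSpace (sf_product m (sfs_mu S)).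

Fixpoint leb (n : nat) : sfspace :=
  match n with
  | 0 => SFSpace (dirac tt : {sigma_finite_measure set unit -> \bar R})
  | k.+1 => sf_prod (@lebesgue_measure R) (leb k)
  end.

Local Notation coords n := (sfs_type (leb n)).
Local Notation lebn n := (sfs_mu (leb n)).

Fixpoint vec (n : nat) : coords n -> 'rV[R]_n :=
  match n with
  | 0 => fun _ => 0
  | k.+1 => fun t => row_mx (const_mx t.1 : 'rV[R]_1) (vec t.2)
  end.

Lemma measurable_coord n (i : 'I_n) : measurable_fun setT (fun t : coords n => vec t 0 i).
Proof.
elim: n i => [[]//|n IH i].
case: (@split_ordP 1 n i) => j ->.
  rewrite (_ : (fun _ => _) = fst); first exact: measurable_fst.
  by apply/funext => t; rewrite (row_mxEl (const_mx t.1 : 'rV_1)) mxE.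
rewrite (_ : (fun _ => _) = (fun t : coords n => vec t 0 j) \o snd).
  exact: (measurableT_comp (IH j) measurable_snd).
by apply/funext => t /=; rewrite (row_mxEr (const_mx t.1 : 'rV_1)).
Qed.

(** Tonelli peels off one coordinate per step. This is the bridge from the iterated integrals of the
    statement to integrals against a measure. *)
Lemma iintE n (h : 'rV[R]_n -> \bar R) :
  (forall x, 0 <= h x)%E -> measurable_fun [set: coords n] (fun t => h (vec t)) ->
  iint h = (\int[lebn n]_t h (vec t))%E.
Proof.
elim: n h => [h h0 mh|n IH h h0 mh] /=.
  by rewrite integral_dirac//= diracT mul1e.
rewrite /sf_product.
rewrite fubini_tonelli1//=.
apply: eq_integral => x _; rewrite /fubini_F IH//.
exact: (measurableT_comp mh (pair1_measurable x)).
Qed.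

End coordinate_space.

Local Notation coords n := (sfs_type (leb _ n)).
Local Notation lebn n := (sfs_mu (leb _ n)).

Lemma measurable_bool_set d (T : measurableType d) (b : T -> bool) :
  measurable_fun setT b -> measurable [set x | b x].
Proof.
move=> mb; rewrite -[X in measurable X]setTI.
exact: (mb measurableT [set true]).
Qed.

Lemma integral_is_derive (R : realType) (f F : R -> R) (a b : R) : a <= b ->
  continuous f -> (forall x : R, is_derive x 1 F (f x)) ->
  (\int[@lebesgue_measure R]_(x in `[a, b]) (f x)%:E = (F b - F a)%:E)%E.
Proof.
rewrite le_eqVlt => /predU1P[<-|ab] cf dF.
  by rewrite set_itv1 integral_set1 subrr.
have dFx x : derivable F x 1 by exact: ex_derive.
have cF : continuous F.
  by move=> x; apply: differentiable_continuous; exact/derivable1_diffP.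
rewrite EFinB; apply: continuous_FTC2 => //.
- exact: continuous_subspaceT.
- split; first by move=> x _; exact: dFx.
  + by apply: cvg_at_right_filter; exact: cF.
  + by apply: cvg_at_left_filter; exact: cF.
- by move=> x _; rewrite derive1E; exact: derive_val.
Qed.

(** The image of Lebesgue measure under x -> c x, multiplied by c, gives half-open intervals their
    length, hence is Lebesgue measure by uniqueness. *)
Lemma ge0_integral_lebesgue_scale (R : realType) (c : R) (f : R -> \bar R) :
  0 < c -> (forall x, 0 <= f x)%E -> measurable_fun setT f ->
  (\int[@lebesgue_measure R]_x f (c * x)%R = c^-1%:E * \int[@lebesgue_measure R]_x f x)%E.
Proof.
move=> c0 f0 mf.
have mc : measurable_fun [set: measurableTypeR R] (fun x : measurableTypeR R => c * x : measurableTypeR R).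
  by apply: measurable_funM => //; exact: measurable_cst.
have c0' : 0 <= c by exact: ltW.
pose nu0 :=
  mscale (NngNum c0') (pushforward (@lebesgue_measure R) (fun x : measurableTypeR R => c * x : measurableTypeR R)) : {measure set measurableTypeR R -> \bar R}.
pose nu := nu0 mc.
have nuE A : measurable A -> lebesgue_measure A = nu A.
  apply: lebesgue_measure_unique => X [[a b] _ <-] /=.
  rewrite /nu /nu0 /mscale /= /pushforward.
  have -> : (fun x : R => c * x) @^-1` `]a, b]%classic = `]a / c, b / c]%classic.
    by apply/seteqP; split => x /=; rewrite !in_itv/= ltr_pdivrMr// ler_pdivlMr// (mulrC c).
  rewrite !lebesgue_measure_itv/= !lte_fin ltr_pM2r ?invr_gt0//.
  case: ifPn => _; last by rewrite mule0.
  by rewrite -!EFinB -EFinM -mulrBl mulrC divfK// gt_eqF.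
rewrite [in RHS](eq_measure_integral nu); last by move=> A mA _; exact: nuE.
rewrite ge0_integral_mscale//= muleA -EFinM mulVf ?gt_eqF// mul1e.
by rewrite ge0_integral_pushforward//= => y _.
Qed.

Section scaling.
Variable R : realType.

Lemma ge0_integral_scale n (c : R) (h : 'rV[R]_n -> \bar R) :
  0 < c -> (forall x, 0 <= h x)%E ->
  measurable_fun [set: coords n] (fun t => h (vec t)) ->
  measurable_fun [set: coords n] (fun t => h (c *: vec t)) ->
  (\int[lebn n]_t h (c *: vec t) = (c ^- n)%:E * \int[lebn n]_t h (vec t))%E.
Proof.
move=> c0; elim: n h => [|n IH] h h0 mh mch.
  rewrite /= !integral_dirac//= !diracT !mul1e scaler0 expr0 invr1.
  by rewrite mul1e.
rewrite /= /sf_product !fubini_tonelli1//.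
have cE x (t : coords n) : c *: row_mx (const_mx x : 'rV_1) (vec t) =
    row_mx (const_mx (c * x) : 'rV_1) (c *: vec t).
  by rewrite scale_row_mx; congr row_mx; apply/rowP => i; rewrite !mxE.
rewrite /fubini_F.
pose G x := (\int[lebn n]_t h (row_mx (const_mx x : 'rV_1) (vec t)))%E.
have mG : measurable_fun setT G by exact: (measurable_fun_fubini_tonelli_F _ mh).
transitivity (\int[@lebesgue_measure R]_x ((c ^- n)%:E * G (c * x)%R))%E.
  apply: eq_integral => x _.
  under eq_integral do rewrite cE.
  rewrite (IH (fun y => h (row_mx (const_mx (c * x) : 'rV_1) y)))//.
  - exact: (measurableT_comp mh (pair1_measurable (c * x))).
  - have := measurableT_comp mch (pair1_measurable x).
    by under eq_fun do rewrite /= cE.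
have cn0 : (0 <= (c ^- n)%:E)%E by rewrite lee_fin invr_ge0 exprn_ge0// ltW.
have G0 x : (0 <= G x)%E by exact: integral_ge0.
have mGc : measurable_fun setT (fun x : measurableTypeR R => G (c * x)).
  by apply: (measurableT_comp mG); apply: measurable_funM => //; exact: measurable_cst.
rewrite (ge0_integralZl _ measurableT mGc (fun x _ => G0 (c * x)) cn0).
rewrite (ge0_integral_lebesgue_scale c0 G0 mG).
by rewrite muleA -EFinM exprSr invfM mulrC.
Qed.

End scaling.

(** * Polar decomposition and integration along lines *)

Lemma measurable_inv (R : realType) : measurable_fun [set: R] (@GRing.inv R).
Proof.
rewrite -(setvU [set 0]); apply/measurable_funU.
- by apply: measurableC; exact: measurable_set1.
- exact: measurable_set1.
split; last exact: measurable_fun_set1.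
apply: open_continuous_measurable_fun.
  rewrite (_ : ~` _ = [set x | x != 0]); first exact: open_neq.
  by apply/seteqP; split => x /= /eqP.
by move=> x; rewrite inE /= => /eqP x0; exact: inv_continuous.
Qed.

Section enorm.
Variable R : realType.

Definition normalize n (y : 'rV[R]_n) : 'rV[R]_n := (enorm y)^-1 *: y.

Lemma enorm_ge0 n (y : 'rV[R]_n) : 0 <= enorm y.
Proof. exact: sqrtr_ge0. Qed.

Lemma enorm_sqr n (y : 'rV[R]_n) : enorm y ^+ 2 = \sum_i y 0 i ^+ 2.
Proof. by rewrite sqr_sqrtr// sumr_ge0// => i _; exact: sqr_ge0. Qed.

Lemma enormZ n (c : R) (y : 'rV[R]_n) : 0 <= c -> enorm (c *: y) = c * enorm y.
Proof.
move=> c0; rewrite /enorm; under eq_bigr do rewrite mxE exprMn.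
by rewrite -mulr_sumr sqrtrM ?sqr_ge0// sqrtr_sqr ger0_norm.
Qed.

Lemma normalizeZ n (c : R) (y : 'rV[R]_n) : 0 < c -> normalize (c *: y) = normalize y.
Proof.
move=> c0; rewrite /normalize enormZ ?ltW// scalerA invfM mulrAC mulVf ?gt_eqF//.
by rewrite mul1r.
Qed.

Lemma measurable_enorm n : measurable_fun [set: coords n] (fun t => enorm (vec t) : R).
Proof.
apply: (measurableT_comp (continuous_measurable_fun (@sqrt_continuous R))).
apply: measurable_sum => i; apply: measurable_funX; exact: measurable_coord.
Qed.

Lemma measurable_normalize n (i : 'I_n) :
  measurable_fun [set: coords n] (fun t => normalize (vec t) 0 i : R).
Proof.
rewrite (_ : (fun _ => _) = (fun t => (enorm (vec t))^-1 * vec t 0 i)).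
  apply: measurable_funM; last exact: measurable_coord.
  exact: (measurableT_comp (@measurable_inv R) (@measurable_enorm n)).
by apply/funext => t; rewrite mxE.
Qed.

Definition pball n : set (coords n) := [set t | @punct_ball R n (vec t)].

Lemma measurable_pball n : measurable (@pball n).
Proof.
apply: measurable_bool_set; apply: measurable_and.
  by apply: measurable_fun_ltr => //; exact: measurable_enorm.
by apply: measurable_fun_ler => //; exact: measurable_enorm.
Qed.

(** Write 1 - |y|^2 as the integral of 2 s over s in [|y|, 1] and exchange the integrals. The
    function is constant along rays, so the ball of radius s contributes s^n times the unit ball,
    and 2 s^(n+1) integrates to 2/(n+2). No polar coordinates are needed. *)
Lemma integral_polar n (phi : 'rV[R]_n -> R) :
  (forall x, 0 <= phi x) ->
  measurable_fun [set: coords n] (fun t => phi (normalize (vec t))) ->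
  (\int[lebn n]_(t in @pball n) (phi (normalize (vec t)) * (1 - enorm (vec t) ^+ 2))%:E
   = (2 / n.+2%:R)%:E * \int[lebn n]_(t in @pball n) (phi (normalize (vec t)))%:E)%E.
Proof.
move=> phi0 mphi.
pose b (s : R) (y : 'rV[R]_n) : bool := (0 < enorm y) && (enorm y <= s).
pose F (z : measurableTypeR R * coords n) : \bar R :=
  (2 * z.1 * phi (normalize (vec z.2)) *
    (b z.1 (vec z.2) && (z.1 <= 1))%:R)%:E.
have F0 z : (0 <= F z)%E.
  rewrite lee_fin; case: (boolP (b _ _ && _)) => [/andP[/andP[h1 h2] _]|]; last by rewrite mulr0.
  by rewrite mulr1 mulr_ge0// mulr_ge0// (le_trans _ h2)// ltW.
have mvec2 : measurable_fun setT (fun z : measurableTypeR R * coords n => enorm (vec z.2) : R).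
  exact: (measurableT_comp (@measurable_enorm n) measurable_snd).
have mF : measurable_fun setT F.
  apply/measurable_EFinP; apply: measurable_funM.
    apply: measurable_funM.
      by apply: measurable_funM => //; exact: measurable_fst.
    exact: (measurableT_comp mphi measurable_snd).
  apply: (@measurableT_comp _ _ _ _ _ _ (fun b : bool => b%:R : R)) => //.
  apply: measurable_and; last first.
    by apply: measurable_fun_ler => //; exact: measurable_fst.
  apply: measurable_and; first exact: measurable_fun_ltr.
  by apply: measurable_fun_ler => //; exact: measurable_fst.
have := @fubini_tonelli _ _ _ _ R (@lebesgue_measure R) (lebn n) F mF F0.
have -> : (\int[lebn n]_y \int[@lebesgue_measure R]_x F (x, y) =
  \int[lebn n]_(t in @pball n) (phi (normalize (vec t)) * (1 - enorm (vec t) ^+ 2))%:E)%E.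
  rewrite [RHS]integral_mkcond; apply: eq_integral => t _.
  rewrite patchE; case: ifPn => [|tB].
    rewrite inE => /andP[t0 t1].
    transitivity (\int[@lebesgue_measure R]_(x in `[enorm (vec t), 1%R])
      ((phi (normalize (vec t)) * (2 * x))%:E))%E.
      rewrite [RHS]integral_mkcond; apply: eq_integral => x _.
      rewrite patchE mem_setE in_itv/= /F /= /b t0 /=.
      by case: ifP => _; rewrite ?mulr0// mulr1 mulrC.
    have dF (x : R) : is_derive x 1 (fun x => phi (normalize (vec t)) * x ^+ 2)
        (phi (normalize (vec t)) * (2 * x)).
      apply: (is_derive_eq (is_derive_mul (is_derive_const x _)
        (is_derive_exp 2 (is_derive_ident x)))).
      by rewrite expr1; ring.
    rewrite (integral_is_derive _ _ dF)//; first by rewrite -mulrBr expr1n.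
    by move=> x; apply: cvgM; [exact: cvg_cst|apply: cvgM; [exact: cvg_cst|exact: cvg_id]].
  apply: integral0_eq => x _; rewrite /F /=.
  case: (boolP (b _ _ && _)) => [/andP[/andP[h1 h2] h3]|]; last by rewrite mulr0.
  by move: tB; rewrite notin_setE /pball /= /punct_ball /= h1 (le_trans h2 h3).
move=> <-.
set I := (\int[lebn n]_(t in @pball n) _)%E.
have I0 : (0 <= I)%E by apply: integral_ge0 => t _; rewrite lee_fin.
transitivity (\int[@lebesgue_measure R]_(s in `[0%R, 1%R]) ((2 * s ^+ n.+1)%:E * I))%E.
  rewrite [RHS]integral_mkcond; apply: eq_integral => s _.
  rewrite patchE mem_setE in_itv/=; case: ifPn => [/andP[s0 s1]|s01]; last first.
    apply: integral0_eq => t _; rewrite /F /=.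
    case: (boolP (b _ _ && _)) => [/andP[/andP[h1 h2] h3]|]; last by rewrite mulr0.
    by move: s01; rewrite h3 (le_trans _ h2)// ltW.
  (* Scaling by the inverse of s needs s > 0; at s = 0 both sides vanish because of the factor 2
     s. *)
  move: s0; rewrite le_eqVlt => /predU1P[s0|s0].
    rewrite -s0 expr0n/= mulr0 mul0e; apply: integral0_eq => t _.
    by rewrite /F/= mulr0 !mul0r.
  pose g (y : 'rV[R]_n) : \bar R := (phi (normalize y) * (b 1 y)%:R)%:E.
  have g0 y : (0 <= g y)%E by rewrite lee_fin mulr_ge0.
  have mg c : measurable_fun [set: coords n] (fun t => (phi (normalize (vec t)) * (b c (vec t))%:R)%:E).
    apply/measurable_EFinP; apply: measurable_funM => //.
    apply: (@measurableT_comp _ _ _ _ _ _ (fun b : bool => b%:R : R)) => //.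
    by apply: measurable_and; [apply: measurable_fun_ltr => //|apply: measurable_fun_ler => //];
      exact: measurable_enorm.
  have gE y : g (s^-1 *: y) = (phi (normalize y) * (b s y)%:R)%:E.
    have sV0 : 0 < s^-1 by rewrite invr_gt0.
    rewrite /g (normalizeZ _ sV0) /b (enormZ _ (ltW sV0)).
    by rewrite (pmulr_rgt0 _ sV0) (ler_pdivrMl _ _ s0) mulr1.
  transitivity (\int[lebn n]_t ((2 * s)%:E * g (s^-1 *: vec t)))%E.
    apply: eq_integral => t _; rewrite gE /F /= s1 andbT -EFinM.
    by rewrite !mulrA.
  rewrite ge0_integralZl//; first last.
  - by rewrite lee_fin mulr_ge0// ltW.
  - by rewrite (eq_fun (fun t => gE (vec t))); exact: mg.
  rewrite ge0_integral_scale ?invr_gt0//; first last.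
  - by rewrite (eq_fun (fun t => gE (vec t))); exact: mg.
  - exact: mg.
  rewrite muleA -EFinM exprVn invrK exprS mulrA; congr (_ * _)%E.
  rewrite /I [RHS]integral_mkcond; apply: eq_integral => t _.
  rewrite patchE /g; case: ifPn => [|].
    by rewrite inE /pball /= /punct_ball /= /b => ->; rewrite mulr1.
  by rewrite notin_setE /pball /= /punct_ball /= /b => /negP/negbTE ->; rewrite mulr0.
rewrite ge0_integralZr//; first last.
- by move=> s /=; rewrite in_itv/= => /andP[s0 _]; rewrite lee_fin mulr_ge0// exprn_ge0.
- by apply/measurable_EFinP; apply: measurable_funTS; apply: measurable_funM.
congr (_ * _)%E.
have dF (x : R) : is_derive x 1 (fun s => 2 / n.+2%:R * s ^+ n.+2) (2 * x ^+ n.+1).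
  apply: (is_derive_eq (is_derive_mul (is_derive_const x _)
    (is_derive_exp n.+2 (is_derive_ident x)))).
  by rewrite mul0r add0r mulr1 mulrA divfK// pnatr_eq0.
rewrite (integral_is_derive _ _ dF)//.
- by rewrite expr1n expr0n/= mulr0 subr0 mulr1.
- move=> x; apply: cvgM; first exact: cvg_cst.
  exact: exprn_continuous.
Qed.

End enorm.

Section lines.
Variable R : realType.

(** Fubini with the i-th coordinate integrated innermost. The condition [y 0 i = 0] picks one base
    point on each line parallel to the i-th axis. *)
Lemma integral_lines n (i : 'I_n) (f : 'rV[R]_n -> R) :
  (lebn n).-integrable [set: coords n] (fun t => (f (vec t))%:E) ->
  (forall y : 'rV[R]_n, y 0 i = 0 ->
    (\int[@lebesgue_measure R]_s (f (y + s *: delta_mx 0 i)%R)%:E = 0)%E) ->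
  (\int[lebn n]_t (f (vec t))%:E = 0)%E.
Proof.
elim: n i f => [[]//|n IH i f intf f0].
rewrite /=; set g := (fun t : measurableTypeR R * coords n => (f (row_mx (const_mx t.1 : 'rV_1) (vec t.2)))%:E).
have intg : (@lebesgue_measure R \x lebn n)%E.-integrable setT g by exact: intf.
case: (@split_ordP 1 n i) f0 => j -> f0.
  rewrite /sf_product -(integral21_prod_meas1 intg) /fubini_G.
  apply: integral0_eq => y _; rewrite /g /=.
  rewrite -[RHS](f0 (row_mx (0 : 'rV_1) (vec y))); last by rewrite (row_mxEl (0 : 'rV_1)) mxE.
  apply: eq_integral => x _; congr (f _)%:E.
  apply/rowP => k; case: (@split_ordP 1 n k) => l ->.
    by rewrite [RHS]mxE (row_mxEl (const_mx x : 'rV_1)) (row_mxEl (0 : 'rV_1)) !mxE !ord1 !eqxx mulr1 add0r.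
  rewrite [RHS]mxE (row_mxEr (const_mx x : 'rV_1)) (row_mxEr (0 : 'rV_1)) !mxE.
  by rewrite (_ : _ && _ = false) ?mulr0 ?addr0// -val_eqE /= ord1.
rewrite /sf_product -(integral12_prod_meas1 intg) /fubini_F.
(* Sections are integrable only for almost every first coordinate, so the induction hypothesis makes
   the inner integral vanish only almost everywhere. *)
rewrite (ae_eq_integral (cst 0%E))//; first by rewrite integral0.
  exact: (measurable_fubini_F intg).
have := ae_integrable1 intg.
apply: filterS => x /= intx _.
apply: (IH j (fun y => f (row_mx (const_mx x : 'rV_1) y))) => // y y0.
rewrite -[RHS](f0 (row_mx (const_mx x : 'rV_1) y)); last by rewrite (row_mxEr (const_mx x : 'rV_1)).
apply: eq_integral => s _; congr (f _)%:E.
apply/rowP => k; case: (@split_ordP 1 n k) => l ->.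
  rewrite [RHS]mxE !(row_mxEl (const_mx x : 'rV_1)) !mxE.
  by rewrite (_ : _ && _ = false) ?mulr0 ?addr0// -val_eqE /= ord1.
by rewrite [RHS]mxE !(row_mxEr (const_mx x : 'rV_1)) !mxE -!val_eqE.
Qed.

End lines.

(** * The Stein identity on the sphere *)

Section sphere_bounded.
Variable R : realType.

(** A class of integrands stable under sums, products and composition with continuous functions, so
    that integrability is checked only structurally. The bound is required on the closed ball, which
    contains [normalize y] for every [y], including 0, where the inverse of 0 is 0. *)
Definition sbdd n (phi : 'rV[R]_n -> R) :=
  measurable_fun [set: coords n] (fun t => phi (normalize (vec t))) /\
  exists K, forall x, enorm x <= 1 -> `|phi x| <= K.

Lemma sbdd_cst n (c : R) : sbdd (fun _ : 'rV[R]_n => c).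
Proof. by split; [exact: measurable_cst|exists `|c|]. Qed.

Lemma sbdd_coord n (i : 'I_n) : sbdd (fun x : 'rV[R]_n => x 0 i).
Proof.
split; first exact: measurable_normalize.
exists 1 => x x1; rewrite -(@ler_pXn2r _ 2)// ?nnegrE// real_normK ?num_real// expr1n.
apply: (@le_trans _ _ (enorm x ^+ 2)); last by rewrite expr_le1// enorm_ge0.
by rewrite enorm_sqr (bigD1 i)//= lerDl sumr_ge0// => j _; exact: sqr_ge0.
Qed.

Lemma sbddD n (f g : 'rV[R]_n -> R) : sbdd f -> sbdd g -> sbdd (fun x => f x + g x).
Proof.
move=> [mf [K fK]] [mg [L gL]]; split; first exact: measurable_funD.
exists (K + L) => x x1; rewrite (le_trans (ler_normD _ _))// lerD//; by [exact: fK|exact: gL].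
Qed.

Lemma sbddM n (f g : 'rV[R]_n -> R) : sbdd f -> sbdd g -> sbdd (fun x => f x * g x).
Proof.
move=> [mf [K fK]] [mg [L gL]]; split; first exact: measurable_funM.
exists (K * L) => x x1; rewrite normrM ler_pM//; by [exact: fK|exact: gL].
Qed.

Lemma sbddN n (f : 'rV[R]_n -> R) : sbdd f -> sbdd (fun x => - f x).
Proof.
move=> sf; have := sbddM (sbdd_cst _ (-1)) sf.
by congr sbdd; apply/funext => x; rewrite mulN1r.
Qed.

Lemma sbddB n (f g : 'rV[R]_n -> R) : sbdd f -> sbdd g -> sbdd (fun x => f x - g x).
Proof. by move=> sf sg; apply: sbddD => //; exact: sbddN. Qed.

Lemma sbddX n (f : 'rV[R]_n -> R) k : sbdd f -> sbdd (fun x => f x ^+ k).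
Proof.
move=> sf; elim: k => [|k IH]; first exact: sbdd_cst.
by under eq_fun do rewrite exprS; exact: sbddM.
Qed.

Lemma sbdd_sum n (I : Type) (s : seq I) (f : I -> 'rV[R]_n -> R) :
  (forall i, sbdd (f i)) -> sbdd (fun x => \sum_(i <- s) f i x).
Proof.
move=> sf; elim: s => [|i s IH].
  by under eq_fun do rewrite big_nil; exact: sbdd_cst.
by under eq_fun do rewrite big_cons; exact: sbddD.
Qed.

Lemma sbdd_comp n (f : 'rV[R]_n -> R) (g : R -> R) : sbdd f -> continuous g ->
  sbdd (fun x => g (f x)).
Proof.
move=> [mf [K fK]] cg; split.
  exact: (measurableT_comp (continuous_measurable_fun cg) mf).
have cag : continuous (fun x => `|g x|).
  by move=> x; apply: (continuous_comp (cg x)); exact: norm_continuous.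
have K0 : - `|K| <= `|K| by rewrite ge0_cp.
have [c _ gc] := EVT_max K0 (continuous_subspaceT cag).
exists (`|g c|) => x x1; apply: gc.
by rewrite in_itv/= -ler_norml (le_trans (fK x x1))// ler_norm.
Qed.

Lemma sbdd_norm n (f : 'rV[R]_n -> R) : sbdd f -> sbdd (fun x => `|f x|).
Proof. by move=> sf; apply: sbdd_comp => //; exact: norm_continuous. Qed.

Lemma enorm_normalize n (y : 'rV[R]_n) : enorm (normalize y) <= 1.
Proof.
rewrite enormZ ?invr_ge0 ?enorm_ge0//.
have [->|y0] := eqVneq (enorm y) 0; first by rewrite mulr0.
by rewrite mulVf.
Qed.

Section finite_volume.
Variable n : nat.
Hypothesis volB : (lebn n (@pball R n) < +oo)%E.

Lemma integrable_pball (f : coords n -> R) K : measurable_fun setT f ->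
  (forall t, pball t -> `|f t| <= K) -> (lebn n).-integrable (@pball R n) (EFin \o f).
Proof.
move=> mf fK; apply: measurable_bounded_integrable => //.
- exact: measurable_pball.
- exact: measurable_funTS.
- exists K; split; first exact: num_real.
  by move=> x Kx t tB /=; exact: (le_trans (fK t tB) (ltW Kx)).
Qed.

Lemma sbdd_integrable phi (g : coords n -> R) : sbdd phi ->
  measurable_fun setT g -> (forall t, pball t -> `|g t| <= 1) ->
  (lebn n).-integrable (@pball R n) (EFin \o (fun t => phi (normalize (vec t)) * g t)).
Proof.
move=> [mphi [K phiK]] mg g1.
apply: (@integrable_pball _ K); first exact: measurable_funM.
move=> t tB; rewrite normrM -[K]mulr1 ler_pM//; last exact: g1.
by apply: phiK; exact: enorm_normalize.
Qed.

Lemma sbdd_integrable1 phi : sbdd phi ->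
  (lebn n).-integrable (@pball R n) (EFin \o (fun t => phi (normalize (vec t)))).
Proof.
move=> [mphi [K phiK]]; apply: (@integrable_pball _ K) => // t _.
by apply: phiK; exact: enorm_normalize.
Qed.

(** The spherical expectation times the volume of the ball; leaving it unnormalized keeps divisions
    out of the identities. *)
Definition sint (phi : 'rV[R]_n -> R) : R :=
  \int[lebn n]_(t in @pball R n) (phi (normalize (vec t))).

Lemma sintD f g : sbdd f -> sbdd g -> sint (fun x => f x + g x) = sint f + sint g.
Proof.
move=> sf sg; rewrite /sint RintegralD//.
- exact: measurable_pball.
- exact: sbdd_integrable1.
- exact: sbdd_integrable1.
Qed.

Lemma sintZ (c : R) f : sbdd f -> sint (fun x => c * f x) = c * sint f.
Proof.
move=> sf; rewrite /sint RintegralZl//; first exact: measurable_pball.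
exact: sbdd_integrable1.
Qed.

Lemma sintB f g : sbdd f -> sbdd g -> sint (fun x => f x - g x) = sint f - sint g.
Proof.
move=> sf sg; rewrite /sint RintegralB//.
- exact: measurable_pball.
- exact: sbdd_integrable1.
- exact: sbdd_integrable1.
Qed.

Lemma sint_sum (I : Type) (s : seq I) (f : I -> 'rV[R]_n -> R) :
  (forall i, sbdd (f i)) -> sint (fun x => \sum_(i <- s) f i x) = \sum_(i <- s) sint (f i).
Proof.
move=> sf; elim: s => [|i s IH].
  rewrite big_nil; under [X in sint X]eq_fun do rewrite big_nil.
  by rewrite /sint Rintegral_cst ?mul0r//; exact: measurable_pball.
rewrite big_cons -IH -sintD//; last exact: sbdd_sum.
by under [X in sint X]eq_fun do rewrite big_cons.
Qed.

(** Because the ball is punctured, [normalize] sends each of its points to a true unit vector, so a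
    comparison on the sphere is enough. *)
Lemma le_sint f g : sbdd f -> sbdd g -> (forall x, enorm x = 1 -> f x <= g x) ->
  sint f <= sint g.
Proof.
move=> sf sg fg; rewrite /sint le_Rintegral//.
- exact: measurable_pball.
- exact: sbdd_integrable1.
- exact: sbdd_integrable1.
- move=> t /andP[t0 _]; apply: fg.
  by rewrite enormZ ?invr_ge0 ?enorm_ge0// mulVf// gt_eqF.
Qed.

Lemma eq_sint f g : (forall x, enorm x = 1 -> f x = g x) -> sint f = sint g.
Proof.
move=> fg; apply: eq_Rintegral => t; rewrite inE => /andP[t0 _]; apply: fg.
by rewrite enormZ ?invr_ge0 ?enorm_ge0// mulVf// gt_eqF.
Qed.

Lemma sint_cst (c : R) : sint (fun=> c) = c * fine (lebn n (@pball R n)).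
Proof. by rewrite /sint Rintegral_cst//; exact: measurable_pball. Qed.

Lemma sint_ge0 f : (forall x, enorm x = 1 -> 0 <= f x) -> 0 <= sint f.
Proof.
move=> f0; apply: Rintegral_ge0 => t /andP[t0 _]; apply: f0.
by rewrite enormZ ?invr_ge0 ?enorm_ge0// mulVf// gt_eqF.
Qed.

Lemma measurable_radius :
  measurable_fun [set: coords n] (fun t => 1 - enorm (vec t : 'rV[R]_n) ^+ 2).
Proof.
apply: measurable_funB; first exact: measurable_cst.
by apply: measurable_funX; exact: measurable_enorm.
Qed.

Lemma radius_le1 (t : coords n) : @pball R n t -> `|1 - enorm (vec t : 'rV[R]_n) ^+ 2| <= 1.
Proof.
move=> /andP[t0 t1]; have e0 := enorm_ge0 (vec t).
have e1 : enorm (vec t) ^+ 2 <= 1 by rewrite expr_le1.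
by rewrite ger0_norm ?subr_ge0// lerBlDr lerDl exprn_ge0.
Qed.

Lemma sint_polar phi : sbdd phi ->
  \int[lebn n]_(t in @pball R n) (phi (normalize (vec t)) * (1 - enorm (vec t) ^+ 2))
  = 2 / n.+2%:R * sint phi.
Proof.
have ge0_case f : sbdd f -> (forall x, 0 <= f x) ->
    \int[lebn n]_(t in @pball R n) (f (normalize (vec t)) * (1 - enorm (vec t) ^+ 2))
    = 2 / n.+2%:R * sint f.
  move=> [mf Kf] f0; rewrite /Rintegral integral_polar// fineM//.
  exact: (integrable_fin_num (measurable_pball _ _) (sbdd_integrable1 (conj mf Kf))).
move=> sphi.
(* Tonelli handled nonnegative functions only; the signed case follows by splitting into positive
   and negative parts. *)
have pos (f : 'rV[R]_n -> R) : sbdd f -> sbdd (fun x => Num.max (f x) 0).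
  move=> sf; apply: (@sbdd_comp _ f (fun x => Num.max x 0) sf) => x.
  by apply: (@continuous_max R R id (cst 0)); [exact: cvg_id|exact: cvg_cst].
have p1 := pos _ sphi; have p2 := pos _ (sbddN sphi).
have E x : phi x = Num.max (phi x) 0 - Num.max (- phi x) 0.
  by case: (lerP 0 (phi x)) => h; [rewrite max_r ?oppr_le0 ?subr0|rewrite max_l ?oppr_ge0 1?ltW ?opprK ?add0r].
have -> : sint phi = sint (fun x => Num.max (phi x) 0) - sint (fun x => Num.max (- phi x) 0).
  by rewrite -sintB//; apply: eq_sint => x _; exact: E.
rewrite mulrBr -!ge0_case//; [|by move=> x; rewrite le_max lexx orbT..].
rewrite -RintegralB//.
- by apply: eq_Rintegral => t _; rewrite [in LHS]E mulrBl.
- exact: measurable_pball.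
- exact: (sbdd_integrable p1 measurable_radius radius_le1).
- exact: (sbdd_integrable p2 measurable_radius radius_le1).
Qed.

End finite_volume.
End sphere_bounded.

(** * The divergence along a line *)

Section line_integral.
Variables (R : realType) (psi dpsi : R -> R).
Hypothesis psiE : forall x : R, is_derive x 1 psi (dpsi x).
Hypothesis cdpsi : continuous dpsi.

(** The derivative in t of (1 - (s + t^2)) (b + a t) psi(w(t)). On the line y + t e_i with y_i = 0,
    the parameters are s = |y|^2, b = (My)_i, a = M_ii, and w is q(z/|z|). The function w stays
    abstract because on the line through 0 it is replaced by a constant. *)
Definition line_div (s b a : R) (w dw : R -> R) (t : R) : R :=
  - 2 * t * (b + a * t) * psi (w t) +
  (1 - (s + t ^+ 2)) * (a * psi (w t) + (b + a * t) * (dpsi (w t) * dw t)).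

Lemma continuous_line_div (s b a : R) (w dw : R -> R) : (forall x : R, is_derive x 1 w (dw x)) ->
  continuous dw -> continuous (line_div s b a w dw).
Proof.
move=> wE cdw x.
have cw : {for x, continuous w} := is_derive_continuous (wE x).
have cpw : {for x, continuous (fun t => psi (w t))}.
  by apply: (continuous_comp cw); exact: is_derive_continuous (psiE _).
have cdpw : {for x, continuous (fun t => dpsi (w t))}.
  by apply: (continuous_comp cw); exact: cdpsi.
have cx : {for x, continuous (fun t : R => t)} by exact: cvg_id.
have cc (c : R) : {for x, continuous (fun _ : R => c)} by exact: cvg_cst.
have cl : {for x, continuous (fun t => b + a * t)}.
  by apply: cvgD; [exact: cc|apply: cvgM; [exact: cc|exact: cx]].
apply: cvgD.
  apply: cvgM => //; apply: cvgM => //; apply: cvgM => //; exact: cc.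
apply: cvgM.
  apply: cvgB; first exact: cc.
  by apply: cvgD; [exact: cc|exact: exprn_continuous].
apply: cvgD; first by apply: cvgM => //; exact: cc.
by apply: cvgM => //; apply: cvgM => //; exact: cdw.
Qed.

(** The primitive carries the factor 1 - (s + t^2), which is 0 at both ends of the chord. *)
Lemma integral_line_div (s b a : R) (w dw : R -> R) : s < 1 -> (forall x : R, is_derive x 1 w (dw x)) ->
  continuous dw ->
  (\int[@lebesgue_measure R]_(t in `[(- Num.sqrt (1 - s))%R, (Num.sqrt (1 - s))%R])
    (line_div s b a w dw t)%:E = 0)%E.
Proof.
move=> s1 wE cdw.
pose G t := (1 - (s + t ^+ 2)) * ((b + a * t) * psi (w t)).
have dG (x : R) : is_derive x 1 G (line_div s b a w dw x).
  apply: (is_derive_eq (is_derive_mul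
    (is_derive_sub (is_derive_const x 1)
       (is_derive_add (is_derive_const x s) (is_derive_exp 2 (is_derive_ident x))))
    (is_derive_mul (is_derive_add (is_derive_const x b)
       (is_derive_mul (is_derive_const x a) (is_derive_ident x)))
       (is_derive_compf (wE x) (psiE (w x)))))).
  by rewrite /line_div expr1; ring.
have s0 : 0 <= Num.sqrt (1 - s) by exact: sqrtr_ge0.
rewrite (integral_is_derive _ _ dG).
- rewrite /G sqrrN sqr_sqrtr; last by rewrite subr_ge0 ltW.
  by rewrite (_ : 1 - (s + (1 - s)) = 0) ?mul0r ?subrr//; ring.
- by rewrite ge0_cp.
- exact: continuous_line_div.
Qed.

(** Three positions of the line. If s >= 1, it meets the ball at most at t = 0 with s = 1, where the
    integrand is 0. If 0 < s < 1, the quotient w is smooth and the chord lemma applies. If s = 0,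
    the line passes through 0, which is why the hypothesis forces b = q0 = 0. *)
Lemma integral_line_punctured (s b a q0 : R) : 0 <= s -> (s = 0 -> b = 0 /\ q0 = 0) ->
  let w t := (q0 + 2 * b * t + a * t ^+ 2) / (s + t ^+ 2) in
  let dw t := 2 * (b + a * t) / (s + t ^+ 2) -
    2 * t * (q0 + 2 * b * t + a * t ^+ 2) / (s + t ^+ 2) ^+ 2 in
  (\int[@lebesgue_measure R]_t
    ((0 < s + t ^+ 2 <= 1)%R%:R * line_div s b a w dw t)%:E = 0)%E.
Proof.
move=> s0 sb w dw.
have [s1|s1] := leP 1 s.
  apply: integral0_eq => t _; case: (boolP (_ < _ <= _)) => [/andP[_ h]|]; last by rewrite mul0r.
  have t0 : t ^+ 2 = 0.
    by apply/eqP; rewrite eq_le sqr_ge0 andbT -(lerD2l s) addr0 (le_trans h).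
  have {}t0 : t = 0 by apply/eqP; rewrite -sqrf_eq0 t0.
  have s1' : s = 1 by apply/eqP; rewrite eq_le s1 andbT -[s]addr0 -[X in s + X](expr0n R 2) -{1}t0.
  by rewrite /line_div t0 s1' expr0n/= addr0 subrr !mulr0 !mul0r addr0 mulr0.
have s1' : 0 <= 1 - s by rewrite subr_ge0 ltW.
have itvE t : (s + t ^+ 2 <= 1) = (t \in `[- Num.sqrt (1 - s), Num.sqrt (1 - s)]).
  rewrite in_itv/= -ler_norml -[RHS](@ler_pXn2r _ 2)// ?nnegrE ?sqrtr_ge0//.
  by rewrite (sqr_sqrtr s1') real_normK ?num_real// lerBrDl.
have [s00|s00] := eqVneq s 0; last first.
  have st0 t : s + t ^+ 2 != 0.
    by rewrite gt_eqF// ltr_pwDl ?sqr_ge0// lt_neqAle eq_sym s00.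
  have wE (x : R) : is_derive x 1 w (dw x).
    apply: (is_derive_eq (is_derive_mul
      (is_derive_add (is_derive_add (is_derive_const x q0) (is_derive_mul (is_derive_const x (2 * b)) (is_derive_ident x)))
        (is_derive_mul (is_derive_const x a) (is_derive_exp 2 (is_derive_ident x))))
      (@is_derive_invf _ (fun t => s + t ^+ 2) x _ (st0 x) (is_derive_add (is_derive_const x s) (is_derive_exp 2 (is_derive_ident x)))))).
    by rewrite /dw expr1; field; exact: st0.
  have cdw : continuous dw.
    move=> x.
    have cx : {for x, continuous (fun t : R => t)} by exact: cvg_id.
    have cc (c : R) : {for x, continuous (fun _ : R => c)} by exact: cvg_cst.
    have cl : {for x, continuous (fun t => b + a * t)}.
      by apply: cvgD; [exact: cc|apply: cvgM; [exact: cc|exact: cx]].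
    have cst2 : {for x, continuous (fun t : R => s + t ^+ 2)}.
      by apply: cvgD; [exact: cc|exact: exprn_continuous].
    have cst4 : {for x, continuous (fun t : R => (s + t ^+ 2) ^+ 2)}.
      apply: (@continuous_comp _ _ _ (fun t : R => s + t ^+ 2) (fun z : R => z ^+ 2)) => //.
      exact: exprn_continuous.
    have cq : {for x, continuous (fun t : R => q0 + 2 * b * t + a * t ^+ 2)}.
      apply: cvgD; first by apply: cvgD; [exact: cc|apply: cvgM; [exact: cc|exact: cx]].
      by apply: cvgM; [exact: cc|exact: exprn_continuous].
    apply: cvgB.
      by apply: cvgM; [apply: cvgM => //; exact: cc|exact: cvgV].
    apply: cvgM; first by apply: cvgM => //; apply: cvgM => //; exact: cc.
    apply: cvgV; first by rewrite expf_neq0.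
    exact: cst4.
  rewrite -[RHS](integral_line_div b a s1 wE cdw) [RHS]integral_mkcond.
  apply: eq_integral => t _; rewrite patchE mem_setE -itvE.
  have -> : 0 < s + t ^+ 2 by rewrite lt_neqAle eq_sym st0 addr_ge0// sqr_ge0.
  by case: ifP => _ /=; rewrite ?mul1r ?mul0r.
(* On the line through 0 the quotient equals a for t <> 0. Replacing it by that constant and
   discarding the null set t = 0 reduces to the chord lemma. *)
have [b0 q00] := sb s00.
have aE (x : R) : is_derive x 1 (fun=> a) 0 := is_derive_const x a.
have c0 : continuous (fun _ : R => 0 : R) by move=> x; exact: cvg_cst.
rewrite -[RHS](integral_line_div b a s1 aE c0).
rewrite -[RHS](@integral_setD1 _ _ 0); last 2 first.
- by apply: measurableD => //; exact: measurable_set1.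
- by apply/measurable_EFinP; apply: measurable_funTS; apply: continuous_measurable_fun; exact: continuous_line_div.
rewrite [RHS]integral_mkcond; apply: eq_integral => t _; rewrite patchE.
have [->|t0] := eqVneq t 0.
  rewrite s00 expr0n/= addr0 ltxx mul0r ifF//.
  by apply/negbTE; rewrite notin_setE => -[_ /(_ erefl)].
have t20 : t ^+ 2 != 0 by rewrite sqrf_eq0.
have -> : (t \in `[(- Num.sqrt (1 - s)), (Num.sqrt (1 - s))]%classic `\ 0) = (s + t ^+ 2 <= 1).
  rewrite itvE; apply/idP/idP; first by rewrite inE => -[].
  by move=> h; rewrite inE; split => // /eqP; exact/negP.
have -> : 0 < s + t ^+ 2 by rewrite s00 add0r lt_neqAle eq_sym t20 sqr_ge0.
have wa : w t = a by rewrite /w s00 b0 q00 mulr0 mul0r !add0r mulfK.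
have dw0 : dw t = 0.
  by rewrite /dw s00 b0 q00; field.
by case: ifP => _ /=; rewrite ?mul1r ?mul0r// /line_div wa dw0.
Qed.

End line_integral.

(** * Quadratic forms and their restriction to lines *)

Section quadratic_forms.
Variables (R : realType) (n : nat) (M : 'M[R]_n).
Implicit Types (x y : 'rV[R]_n) (i : 'I_n).

Definition mvec x i : R := \sum_j M i j * x 0 j.

Lemma qform_mvec x : qform M x = \sum_i x 0 i * mvec x i.
Proof.
apply: eq_bigr => i _; rewrite /mvec mulr_sumr.
by apply: eq_bigr => j _; rewrite mulrCA mulrA.
Qed.

Lemma mvecZ c x i : mvec (c *: x) i = c * mvec x i.
Proof.
by rewrite /mvec mulr_sumr; apply: eq_bigr => j _; rewrite mxE mulrCA.
Qed.

Lemma qformZ c x : qform M (c *: x) = c ^+ 2 * qform M x.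
Proof.
rewrite !qform_mvec mulr_sumr; apply: eq_bigr => i _.
by rewrite mvecZ mxE expr2 mulrACA.
Qed.

Lemma mvec_line y t i k : mvec (y + t *: delta_mx 0 i) k = mvec y k + t * M k i.
Proof.
rewrite /mvec; under eq_bigr do rewrite !mxE eqxx /= mulrDr.
rewrite big_split/=; congr (_ + _).
rewrite (bigD1 i)//= eqxx mulr1 big1 ?addr0 1?mulrC// => j ji.
by rewrite (negbTE ji) !mulr0.
Qed.

Lemma enorm_line y t i : y 0 i = 0 ->
  enorm (y + t *: delta_mx 0 i) ^+ 2 = enorm y ^+ 2 + t ^+ 2.
Proof.
move=> yi; rewrite !enorm_sqr (bigD1 i)//= [in RHS](bigD1 i)//=.
rewrite !mxE yi !eqxx mulr1 add0r expr0n/= add0r addrC; congr (_ + _).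
by apply: eq_bigr => j ji; rewrite !mxE (negbTE ji) mulr0 addr0.
Qed.

Hypothesis symM : M^T = M.

Lemma qform_line y t i : y 0 i = 0 -> qform M (y + t *: delta_mx 0 i) =
  qform M y + 2 * mvec y i * t + M i i * t ^+ 2.
Proof.
move=> yi; rewrite !qform_mvec.
under eq_bigr do rewrite mvec_line !mxE eqxx /= mulrDl !mulrDr.
rewrite !big_split/= -!addrA; congr (_ + _).
have -> : \sum_k y 0 k * (t * M k i) = t * mvec y i.
  rewrite /mvec mulr_sumr; apply: eq_bigr => k _.
  by rewrite mulrCA -{1}symM mxE (mulrC (y _ _)).
rewrite (bigD1 i)//= eqxx big1 => [|k /negbTE ->]; last by rewrite mulr0 mul0r.
rewrite (bigD1 i)//= eqxx big1 => [|k /negbTE ->]; last by rewrite mulr0 mul0r.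
by rewrite !addr0 /= !mulr1; ring.
Qed.

Lemma sbdd_mvec i : sbdd (fun x => mvec x i).
Proof.
by apply: sbdd_sum => j; apply: sbddM; [exact: sbdd_cst|exact: sbdd_coord].
Qed.

Lemma sbdd_qform : sbdd (qform M).
Proof.
rewrite (funext qform_mvec); apply: sbdd_sum => j.
by apply: sbddM; [exact: sbdd_coord|exact: sbdd_mvec].
Qed.

Lemma sum_mvec_sqr x : \sum_i mvec x i ^+ 2 = qform (M *m M) x.
Proof.
rewrite /qform (eq_bigr (fun i => \sum_j \sum_k (M i j * x 0 j) * (M i k * x 0 k))).
  rewrite exchange_big /=; apply: eq_bigr => j _.
  rewrite exchange_big /=; apply: eq_bigr => k _.
  rewrite mxE !mulr_suml; apply: eq_bigr => i _.
  by rewrite -[in M j i]symM mxE mulrACA mulrA.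
by move=> i _; rewrite expr2 mulr_suml; apply: eq_bigr => j _; rewrite mulr_sumr.
Qed.

End quadratic_forms.

Section stein_identity.
Variables (R : realType) (n : nat) (M : 'M[R]_n).
Hypothesis symM : M^T = M.
Hypothesis volB : (lebn n (@pball R n) < +oo)%E.
Variables (psi dpsi : R -> R).
Hypothesis psiE : forall x : R, is_derive x 1 psi (dpsi x).
Hypothesis cdpsi : continuous dpsi.

(** The angular parts of the i-th term of the divergence: [P] comes from differentiating the cutoff
    and has weight |y|^2, [Q] from differentiating psi(q(y/|y|)) (My)_i and has weight 1 - |y|^2. *)
Let P i (u : 'rV[R]_n) := - 2 * u 0 i * mvec M u i * psi (qform M u).
Let Q i (u : 'rV[R]_n) := M i i * psi (qform M u) +
  dpsi (qform M u) * (2 * mvec M u i * (mvec M u i - qform M u * u 0 i)).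

Let cpsi : continuous psi.
Proof. by move=> x; exact: is_derive_continuous (psiE x). Qed.

Let sbddP i : sbdd (P i).
Proof.
apply: sbddM; last exact: sbdd_comp (sbdd_qform M) cpsi.
apply: sbddM; last exact: sbdd_mvec.
by apply: sbddM; [exact: sbdd_cst|exact: sbdd_coord].
Qed.

Let sbddQ i : sbdd (Q i).
Proof.
apply: sbddD.
  by apply: sbddM; [exact: sbdd_cst|exact: sbdd_comp (sbdd_qform M) cpsi].
apply: sbddM; first exact: sbdd_comp (sbdd_qform M) cdpsi.
apply: sbddM; first by apply: sbddM; [exact: sbdd_cst|exact: sbdd_mvec].
apply: sbddB; first exact: sbdd_mvec.
by apply: sbddM; [exact: sbdd_qform|exact: sbdd_coord].
Qed.

(* [F i] is the i-th term of the divergence of the vector field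
   (1 - |y|^2)_+ psi(q(y/|y|)) My. *)
Let F i (y : 'rV[R]_n) : R := (0 < enorm y <= 1)%R%:R *
  (P i (normalize y) * enorm y ^+ 2 + Q i (normalize y) * (1 - enorm y ^+ 2)).

Let F_line i (y : 'rV[R]_n) : y 0 i = 0 ->
  (\int[@lebesgue_measure R]_t (F i (y + t *: delta_mx 0 i)%R)%:E = 0)%E.
Proof.
move=> yi.
have sb : enorm y ^+ 2 = 0 -> mvec M y i = 0 /\ qform M y = 0.
  rewrite enorm_sqr => /eqP; rewrite psumr_eq0; last by move=> j _; exact: sqr_ge0.
  move=> /allP y0.
  have {}y0 j : y 0 j = 0.
    by apply/eqP; rewrite -sqrf_eq0; apply: (implyP (y0 j _)) => //; rewrite mem_index_enum.
  have m0 k : mvec M y k = 0 by rewrite /mvec big1// => j _; rewrite y0 mulr0.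
  by split => //; rewrite qform_mvec big1// => j _; rewrite y0 mul0r.
have := @integral_line_punctured R psi dpsi psiE cdpsi _ _ (M i i) _ (sqr_ge0 (enorm y)) sb.
move=> /= <-; apply: eq_integral => t _; congr EFin.
rewrite /F /line_div /=; set z := y + _.
have zi : z 0 i = t by rewrite !mxE yi !eqxx mulr1 add0r.
have zr : enorm z ^+ 2 = enorm y ^+ 2 + t ^+ 2 by exact: enorm_line.
rewrite -zr -(qform_line symM t yi) -/z.
have -> : (0 < enorm z ^+ 2 <= 1)%R = (0 < enorm z <= 1)%R.
  rewrite expr_le1 ?enorm_ge0// lt_neqAle sqr_ge0 eq_sym sqrf_eq0.
  by rewrite (lt_neqAle 0) enorm_ge0 (eq_sym 0).
case: (boolP (_ < _ <= _)) => [/andP[z0 z1]|]; last by rewrite !mul0r.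
have z0' : enorm z != 0 by rewrite gt_eqF.
have mz : mvec M z i = mvec M y i + M i i * t by rewrite mvec_line (mulrC t).
rewrite !mul1r /P /Q -mz /normalize qformZ mvecZ mxE zi exprVn.
rewrite [(enorm z ^+ 2)^-1 * _]mulrC.
by field.
Qed.

(** The i-th term of the divergence integrates to 0. Averaging out the weights |y|^2 and 1 - |y|^2
    leaves n/(n+2) on [P] and 2/(n+2) on [Q]. *)
Lemma sint_PQ i : n%:R * sint (P i) + 2 * sint (Q i) = 0.
Proof.
(* The weight |y|^2 is written as 1 - (1 - |y|^2), so that one polar formula serves both parts. *)
pose g t := P i (normalize (vec t)) - P i (normalize (vec t)) * (1 - enorm (vec t) ^+ 2) +
  Q i (normalize (vec t)) * (1 - enorm (vec t) ^+ 2).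
have mB := measurable_pball R n.
have i1 := sbdd_integrable1 volB (sbddP i).
have i2 := sbdd_integrable volB (sbddP i) (@measurable_radius R n) (@radius_le1 R n).
have i3 := sbdd_integrable volB (sbddQ i) (@measurable_radius R n) (@radius_le1 R n).
have i12 : (lebn n).-integrable (@pball R n) (EFin \o (fun t => P i (normalize (vec t)) -
    P i (normalize (vec t)) * (1 - enorm (vec t) ^+ 2))).
  exact: (integrableB mB i1 i2).
have FE t : (F i (vec t))%:E = ((EFin \o g) \_ (@pball R n)) t.
  rewrite patchE /F; case: ifPn.
    rewrite inE /pball /= /punct_ball /= => ->; rewrite mul1r /g /=; congr EFin; ring.
  by rewrite notin_setE /pball /= /punct_ball /= => /negP/negbTE ->; rewrite mul0r.
have intF : (lebn n).-integrable [set: coords n] (fun t => (F i (vec t))%:E).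
  rewrite (funext FE); apply/integrable_restrict => //; rewrite setTI.
  exact: (integrableD mB i12 i3).
have := integral_lines intF (@F_line i).
under eq_integral do rewrite FE.
rewrite -integral_mkcond => /(congr1 (@fine R)); rewrite -/(Rintegral _ _ _) /g.
rewrite RintegralD// RintegralB// !sint_polar// -/(sint (P i)) => /= H.
have n2 : n.+2%:R != 0 :> R by rewrite pnatr_eq0.
have -> : n%:R = n.+2%:R - 2 :> R by rewrite -addn2 natrD addrK.
move: (n.+2%:R : R) n2 H => N N0 H.
by apply: (mulfI (invr_neq0 N0)); rewrite mulr0 -[RHS]H; field.
Qed.

(** Summing over i turns u_i (Mu)_i into q(u) and M_ii into the trace; |Mu|^2 - q(u)^2 is the
    squared length of the part of Mu tangent to the sphere. The trace term is kept because the
    moment computations use the identity for M^2 as well. *)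
Theorem stein_identity : n%:R * sint (fun u => qform M u * psi (qform M u)) =
  \tr M * sint (fun u => psi (qform M u)) +
  2 * sint (fun u => dpsi (qform M u) * (qform (M *m M) u - qform M u ^+ 2)).
Proof.
have spsi : sbdd (fun u => psi (qform M u)) by exact: sbdd_comp (sbdd_qform M) cpsi.
have sdpsi : sbdd (fun u => dpsi (qform M u)) by exact: sbdd_comp (sbdd_qform M) cdpsi.
have sS : sbdd (fun u => qform (M *m M) u - qform M u ^+ 2).
  by apply: sbddB; [exact: sbdd_qform|apply: sbddX; exact: sbdd_qform].
have : \sum_i (n%:R * sint (P i) + 2 * sint (Q i)) = 0.
  by rewrite big1// => i _; exact: sint_PQ.
rewrite big_split/= -!mulr_sumr -!sint_sum//.
have -> : sint (fun u => \sum_i P i u) = - 2 * sint (fun u => qform M u * psi (qform M u)).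
  rewrite -sintZ//; last by apply: sbddM => //; exact: sbdd_qform.
  apply: eq_sint => u _; rewrite /P -mulr_suml mulrA; congr (_ * _).
  by rewrite qform_mvec mulr_sumr; apply: eq_bigr => i _; rewrite mulrA.
have -> : sint (fun u => \sum_i Q i u) = \tr M * sint (fun u => psi (qform M u)) +
  2 * sint (fun u => dpsi (qform M u) * (qform (M *m M) u - qform M u ^+ 2)).
  rewrite -!sintZ//; last exact: sbddM.
  rewrite -sintD//; last 2 first.
  - by apply: sbddM => //; exact: sbdd_cst.
  - by apply: sbddM; [exact: sbdd_cst|exact: sbddM].
  apply: eq_sint => u _; rewrite /Q big_split/= -mulr_suml; congr (_ + _).
  rewrite -mulr_sumr mulrCA; congr (_ * _).
  rewrite -sum_mvec_sqr// [in RHS]expr2 {3}qform_mvec mulr_sumr -sumrB mulr_sumr.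
  by apply: eq_bigr => i _; ring.
move=> H; apply/eqP; rewrite -subr_eq0; apply/eqP.
have two0 : (2 : R) != 0 by rewrite pnatr_eq0.
apply: (mulfI two0); rewrite mulr0 -[RHS]oppr0 -H; ring.
Qed.

End stein_identity.

(** * The Stein equation *)

Section gaussian_density.
Variable R : realType.
Local Notation leb1 := (@lebesgue_measure R).
Local Notation gpdf := (@normal_pdf R 0 1).

Lemma gpdfE x : gpdf x = normal_peak 1 * expR (- (x ^+ 2) / 2).
Proof.
rewrite normal_pdfE ?oner_neq0// /normal_fun subr0 expr1n.
by rewrite (_ : 1 *+ 2 = 2 :> R).
Qed.

Lemma gpdf_gt0 x : 0 < gpdf x.
Proof. by rewrite gpdfE mulr_gt0 ?expR_gt0// normal_peak_gt0 ?oner_neq0. Qed.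

Lemma gpdf_ge0 x : 0 <= gpdf x.
Proof. exact/ltW/gpdf_gt0. Qed.

Lemma gpdfN x : gpdf (- x) = gpdf x.
Proof. by rewrite !gpdfE sqrrN. Qed.

Lemma continuous_gpdf : continuous gpdf.
Proof. by apply: continuous_normal_pdf; exact: oner_neq0. Qed.

Lemma is_derive_gpdf (x : R) : is_derive x 1 gpdf (- x * gpdf x).
Proof.
rewrite (funext gpdfE).
have d2 : is_derive x 1 (fun t : R => 0 - t ^+ 2) (0 - 2 * x ^+ 1 * 1).
  exact: (is_derive_sub (is_derive_const x 0) (is_derive_exp 2 (is_derive_ident x))).
under eq_fun do rewrite -[- (_ ^+ 2)]sub0r.
apply: (is_derive_eq (is_derive_mul (is_derive_const x (normal_peak 1))
  (is_derive_compf (is_derive_mul d2 (is_derive_const x 2^-1)) (is_derive_expR _)))).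
by rewrite expr1 sub0r; field.
Qed.

Lemma cvg_gpdf : gpdf x @[x --> +oo] --> 0.
Proof.
rewrite (funext gpdfE) -[X in _ --> X](mulr0 (normal_peak 1)).
apply: cvgMr.
(* The dominating function comes from (x - 1)^2 >= 0, that is - x^2 / 2 <= 1/2 - x. *)
have e0 : expR 2^-1 * expR (- x) @[x --> +oo] --> (0 : R).
  by rewrite -[X in _ --> X](mulr0 (expR 2^-1)); apply: cvgMr; exact: cvgr_expR.
apply: (squeeze_cvgr _ (cvg_cst 0) e0).
near=> x; rewrite expR_ge0 /= -expRD ler_expR.
have := sqr_ge0 (x - 1); nra.
Unshelve. all: by end_near. Qed.

Lemma integrable_gpdf_mul D (k : R -> R) K : measurable D -> measurable_fun setT k ->
  (forall x, `|k x| <= K) -> leb1.-integrable D (EFin \o (fun x => k x * gpdf x)).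
Proof.
move=> mD mk kK.
apply: (@le_integrable _ _ _ _ _ mD _ (fun x => (K * gpdf x)%:E)).
- apply/measurable_EFinP; apply: measurable_funTS; apply: measurable_funM => //.
  exact: measurable_normal_pdf.
- move=> x _ /=; rewrite lee_fin !normrM ler_wpM2r//.
  by rewrite (le_trans (kK x))// ler_norm.
- under eq_fun do rewrite EFinM.
  apply: integrableZl => //.
  by apply: (integrableS measurableT) => //; exact: integrable_normal_pdf.
Qed.

Lemma integrable_gpdf D : measurable D -> leb1.-integrable D (EFin \o gpdf).
Proof.
by move=> mD; apply: (integrableS measurableT) => //; exact: integrable_normal_pdf.
Qed.

(** On the ray x is at most t, and t times the density has minus the density as a primitive. *)
Lemma mills_right (x : R) : 0 <= x -> x * \int[leb1]_(t in `]x, +oo[) gpdf t <= gpdf x.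
Proof.
move=> x0.
have tg0 t : x <= t -> 0 <= t * gpdf t.
  by move=> xt; rewrite mulr_ge0 ?gpdf_ge0// (le_trans x0).
have mg D : measurable_fun D gpdf by apply: measurable_funTS; exact: measurable_normal_pdf.
have dF (t : R) : is_derive t 1 (fun t => 0 - gpdf t) (t * gpdf t).
  apply: (is_derive_eq (is_derive_sub (is_derive_const t 0) (is_derive_gpdf t))).
  by rewrite sub0r mulNr opprK.
have FTC : (\int[leb1]_(t in `[x, +oo[) (t * gpdf t)%:E = (gpdf x)%:E)%E.
  rewrite (@ge0_continuous_FTC2y _ _ (fun t => 0 - gpdf t) x 0).
  - by rewrite -EFinB sub0r sub0r opprK.
  - exact: tg0.
  - apply: continuous_subspaceT => t; apply: cvgM; first exact: cvg_id.
    exact: continuous_gpdf.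
  - rewrite -[X in _ --> X](subr0 0); apply: cvgB; first exact: cvg_cst.
    exact: cvg_gpdf.
  - by move=> t _; have ? := dF t; exact: ex_derive.
  - apply: cvg_at_right_filter; exact: is_derive_continuous (dF x).
  - by move=> t _; rewrite derive1E; have ? := dF t; exact: derive_val.
rewrite -lee_fin EFinM fineK; last first.
  by apply: integrable_fin_num => //; exact: integrable_gpdf.
have mgE D : measurable_fun D (EFin \o gpdf) by exact/measurable_EFinP.
have gE0 (t : R) : `]x, +oo[%classic t -> (0 <= (gpdf t)%:E)%E by rewrite lee_fin gpdf_ge0.
have xE0 : (0 <= x%:E)%E by rewrite lee_fin.
rewrite -FTC -(ge0_integralZl leb1 (measurable_itv `]x, +oo[) (mgE _) gE0 xE0).
have mtg (D : set R) : measurable_fun D (fun t : R => t * gpdf t) by exact: measurable_funM.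
apply: (@le_trans _ _ (\int[leb1]_(t in `]x, +oo[) (t * gpdf t)%:E)%E).
  apply: ge0_le_integral => //=.
  - by move=> t _; rewrite lee_fin mulr_ge0// gpdf_ge0.
  - by apply: measurable_funeM; exact: mgE.
  - by apply/measurable_EFinP; exact: mtg.
  - move=> t; rewrite in_itv/= andbT => xt.
    by rewrite lee_fin ler_pM2r ?gpdf_gt0// ltW.
apply: ge0_subset_integral => //=.
- by apply/measurable_EFinP; exact: mtg.
- by move=> t; rewrite in_itv/= andbT => xt; rewrite lee_fin tg0.
- by move=> t /=; rewrite !in_itv/= !andbT => /ltW.
Qed.

Lemma mills_left (x : R) : x <= 0 -> - x * \int[leb1]_(t in `]-oo, x]) gpdf t <= gpdf x.
Proof.
move=> x0; have nx0 : 0 <= - x by rewrite oppr_ge0.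
rewrite -(gpdfN x); apply: le_trans (mills_right nx0).
rewrite ler_wpM2l// le_eqVlt; apply/orP; left; apply/eqP.
rewrite Rintegral_itv_obnd_cbnd; last exact: integrable_gpdf.
rewrite /Rintegral -[in LHS](opprK x) ge0_integration_by_substitutionNy.
- by congr fine; apply: eq_integral => t _ /=; rewrite gpdfN.
- by apply: continuous_subspaceT; exact: continuous_gpdf.
- by move=> t _; exact: gpdf_ge0.
Qed.

End gaussian_density.

Section stein_equation.
Variables (R : realType) (h : R -> R).
Hypothesis ch : continuous h.
Hypothesis h01 : forall x, 0 <= h x <= 1.
Local Notation leb1 := (@lebesgue_measure R).
Local Notation gpdf := (@normal_pdf R 0 1).

Let m := \int[leb1]_x (h x * gpdf x).

Let mh : measurable_fun setT h. Proof. exact: continuous_measurable_fun. Qed.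

Let h_le1 x : `|h x| <= 1.
Proof. by have /andP[h0 h1] := h01 x; rewrite ger0_norm. Qed.

Let k x := (h x - m) * gpdf x.

Let intk D : measurable D -> leb1.-integrable D (EFin \o k).
Proof.
move=> mD; apply: (@integrable_gpdf_mul _ _ _ (1 + `|m|)) => //.
  exact: measurable_funB.
by move=> x; rewrite (le_trans (ler_normB _ _))// lerD2r.
Qed.

Let int_gpdf1 : \int[leb1]_x gpdf x = 1.
Proof. by rewrite /Rintegral integral_normal_pdf. Qed.

Let m01 : 0 <= m /\ m <= 1.
Proof.
split.
  by apply: Rintegral_ge0 => x _; have /andP[h0 _] := h01 x; rewrite mulr_ge0// gpdf_ge0.
rewrite -int_gpdf1; apply: le_Rintegral => //.
- exact: (@integrable_gpdf_mul _ _ _ 1).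
- exact: integrable_gpdf.
- by move=> x _; have /andP[_ h1] := h01 x; rewrite ler_piMl ?gpdf_ge0.
Qed.

Let int_k : \int[leb1]_x k x = 0.
Proof.
rewrite /k; under eq_Rintegral do rewrite mulrBl.
rewrite RintegralB//.
- rewrite RintegralZl//; last exact: integrable_gpdf.
  by rewrite int_gpdf1 mulr1 subrr.
- exact: (@integrable_gpdf_mul _ _ _ 1).
- exact: (@integrable_gpdf_mul _ _ (fun=> m) `|m|).
Qed.

(** [h - m] lies in [- m, 1 - m], an interval of length one. Keeping both endpoints, instead of a
    bound on its absolute value, is what later yields 1 as bound for psi'. *)
Let k_bounds D : measurable D ->
  - m * \int[leb1]_(x in D) gpdf x <= \int[leb1]_(x in D) k x /\
  \int[leb1]_(x in D) k x <= (1 - m) * \int[leb1]_(x in D) gpdf x.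
Proof.
move=> mD; have ig := integrable_gpdf mD.
have iZ c : leb1.-integrable D (EFin \o (fun x => c * gpdf x)).
  by apply: (@integrable_gpdf_mul _ _ (fun=> c) `|c|).
rewrite -!RintegralZl//; split; apply: le_Rintegral; do ?[exact: mD|exact: intk|exact: iZ].
- move=> x _; rewrite /k ler_wpM2r ?gpdf_ge0// -[leLHS]add0r lerD2r.
  by have /andP[] := h01 x.
- move=> x _; rewrite /k ler_wpM2r ?gpdf_ge0// lerD2r.
  by have /andP[] := h01 x.
Qed.

(** The integrating factor is the Gaussian density: psi is the integral of [k] up to x divided by
    the density at x. The tail estimates place x psi(x) in [- (1 - m), m]. *)
Lemma stein_solution : exists psi dpsi : R -> R,
  [/\ forall x : R, is_derive x 1 psi (dpsi x), continuous dpsi,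
      forall x, dpsi x - x * psi x = h x - \int[leb1]_x (h x * gpdf x) &
      forall x, `|dpsi x| <= 1].
Proof.
pose u x := \int[leb1]_(t in `]-oo, x]) k t.
have ck : continuous k.
  move=> x; apply: cvgM; last exact: continuous_gpdf.
  by apply: cvgB; [exact: ch|exact: cvg_cst].
have du (x : R) : is_derive x 1 u (k x).
  have xx1 : x < x + 1 by rewrite ltrDl.
  have [d1 d2] := @continuous_FTC1 R k -oo%O x (x + 1) xx1 (intk (measurable_itv _)) (ltNyr _) (ck x).
  by apply: DeriveDef; [exact: d1|rewrite -derive1E].
pose psi x := u x * (gpdf x)^-1.
pose dpsi x := x * psi x + (h x - m).
have g0 x : gpdf x != 0 by rewrite gt_eqF// gpdf_gt0.
have dpsiE (x : R) : is_derive x 1 psi (dpsi x).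
  apply: (is_derive_eq (is_derive_mul (du x) (is_derive_invf (g0 x) (is_derive_gpdf x)))).
  by rewrite /dpsi /psi /k; field.
have sandwich (x I J g : R) : 0 <= x -> x * I <= g -> - m * I <= J -> J <= (1 - m) * I ->
    - (1 - m) * g <= x * (- J) <= m * g.
  move=> x0 xI J1 J2; have [m0 m1] := m01.
  have := ler_wpM2l x0 J1; have := ler_wpM2l x0 J2.
  have := ler_wpM2l m0 xI; have m1' : 0 <= 1 - m by rewrite subr_ge0.
  have := ler_wpM2l m1' xI => *; apply/andP; split; lra.
(* For x >= 0 the integral of [k] up to x is minus its right tail, since its total integral is 0;
   for x < 0, [sandwich] applies to - x and the left tail. *)
have bnd x : - (1 - m) * gpdf x <= x * u x <= m * gpdf x.
  have [x0|x0] := leP 0 x.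
    have -> : u x = - \int[leb1]_(t in `]x, +oo[) k t.
      have := @Rintegral_itvB R k -oo%O +oo%O x (intk (measurable_itv _)) (bound_le0x _) (bound_lex1 _).
      by rewrite set_itvNyy int_k sub0r => <-; rewrite opprK.
    have [l1 l2] := k_bounds (measurable_itv `]x, +oo[).
    exact: (sandwich x _ _ _ x0 (mills_right x0)).
  have [l1 l2] := k_bounds (measurable_itv `]-oo, x]).
  have nx0 : 0 <= - x by rewrite oppr_ge0 ltW.
  rewrite -[x * _]mulrNN; exact: (sandwich (- x) _ _ _ nx0 (mills_left (ltW x0))).
exists psi, dpsi; split => //.
- move=> x; apply: cvgD; last by apply: cvgB; [exact: ch|exact: cvg_cst].
  by apply: cvgM; [exact: cvg_id|exact: is_derive_continuous (dpsiE x)].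
- by move=> x; rewrite /dpsi addrAC subrr add0r.
- move=> x; have gx := gpdf_gt0 x.
  have /andP[b1 b2] := bnd x.
  have xp : x * psi x = x * u x / gpdf x by rewrite /psi mulrA.
  have c1 : - (1 - m) <= x * psi x by rewrite xp ler_pdivlMr.
  have c2 : x * psi x <= m by rewrite xp ler_pdivrMr.
  have /andP[h0 h1] := h01 x.
  (* Adding x psi(x) in [- (1 - m), m] to h(x) - m in [- m, 1 - m] gives a value in [-1, 1]. *)
  by rewrite ler_norml /dpsi; apply/andP; split; lra.
Qed.

End stein_equation.

(** * From continuous test functions to Borel sets *)

Section continuous_approximation.
Variables (R : realType) (kappa : {measure set (measurableTypeR R) -> \bar R}).
Hypothesis fin_kappa : (kappa setT < +oo)%E.

Definition capprox (A : set R) := forall e : R, 0 < e -> exists h : R -> R,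
  [/\ continuous h, forall x, 0 <= h x <= 1 &
      (\int[kappa]_x `|h x - \1_A x|%:E <= e%:E)%E].

Let small_tail (D : (set (measurableTypeR R))^nat) (e : R) : 0 < e ->
  (forall k, measurable (D k)) -> nonincreasing_seq D -> \bigcap_k D k = set0 ->
  exists k, (kappa (D k) <= e%:E)%E.
Proof.
move=> e0 mD nD D0.
have D0fin : (kappa (D 0%N) < +oo)%E.
  by apply: le_lt_trans fin_kappa; apply: le_measure; rewrite ?inE//; exact: mD.
have cvD := nonincreasing_cvg_mu D0fin mD (bigcapT_measurable mD) nD.
rewrite D0 measure0 in cvD.
have /fine_cvgP[_ /cvgrPdist_le/(_ _ e0)[k _ Dk]] := cvD.
exists k; have := Dk k (leqnn k); rewrite /= sub0r normrN => le_e.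
have fk : kappa (D k) \is a fin_num.
  rewrite ge0_fin_numE//; apply: le_lt_trans fin_kappa.
  by apply: le_measure; rewrite ?inE//; exact: mD.
by rewrite -(fineK fk) lee_fin (le_trans (ler_norm _)).
Qed.

Let merr (h : R -> R) (A : set R) : continuous h -> measurable A ->
  measurable_fun [set: measurableTypeR R] (fun x => `|h x - \1_A x|%:E).
Proof.
move=> ch mA; apply/measurable_EFinP; apply: measurableT_comp => //.
apply: measurable_funB; first exact: continuous_measurable_fun.
exact: measurable_indic.
Qed.

Let err_le (f f1 f2 : R -> R) (e1 e2 : R) :
  measurable_fun [set: measurableTypeR R] (EFin \o f) ->
  measurable_fun [set: measurableTypeR R] (EFin \o f1) ->
  measurable_fun [set: measurableTypeR R] (EFin \o f2) ->
  (forall x, 0 <= f x) -> (forall x, 0 <= f1 x) -> (forall x, 0 <= f2 x) ->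
  (forall x, f x <= f1 x + f2 x) ->
  (\int[kappa]_x (f1 x)%:E <= e1%:E)%E -> (\int[kappa]_x (f2 x)%:E <= e2%:E)%E ->
  (\int[kappa]_x (f x)%:E <= (e1 + e2)%:E)%E.
Proof.
move=> mf mf1 mf2 f0 f10 f20 fle I1 I2.
apply: (@le_trans _ _ (\int[kappa]_x ((f1 x)%:E + (f2 x)%:E))%E).
  apply: ge0_le_integral => //.
  - by move=> x _; rewrite lee_fin.
  - exact: emeasurable_funD.
  - by move=> x _; rewrite -EFinD lee_fin.
rewrite ge0_integralD//.
- by rewrite EFinD leeD.
- by move=> x _; rewrite lee_fin.
- by move=> x _; rewrite lee_fin.
Qed.

Let capproxT : capprox setT.
Proof.
move=> e e0; exists (fun=> 1); split.
- by move=> x; exact: cvg_cst.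
- by move=> x; rewrite ler01 lexx.
- rewrite integral0_eq ?lee_fin ?ltW// => x _.
  by rewrite indicT subrr normr0.
Qed.

Let capproxC (A : set R) : capprox A -> capprox (~` A).
Proof.
move=> cA e e0; have [h [ch h01 he]] := cA e e0.
exists (fun x => 1 - h x); split.
- by move=> x; apply: cvgB; [exact: cvg_cst|exact: ch].
- by move=> x; have /andP[? ?] := h01 x; rewrite subr_ge0 gerBl; apply/andP; split.
- apply: le_trans he; rewrite le_eqVlt; apply/orP; left; apply/eqP.
  apply: eq_integral => x _; rewrite !indicE in_setC -normrN; congr (`|_|%:E).
  by case: (x \in A) => /=; ring.
Qed.

(** The maximum of the two approximants works: its error is pointwise at most the sum of the two
    errors. *)
Let capproxU (A B : set R) : measurable A -> measurable B ->
  capprox A -> capprox B -> capprox (A `|` B).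
Proof.
move=> mA mB cA cB e e0; have e20 : 0 < e / 2 by rewrite divr_gt0.
have [f [cf f01 fe]] := cA _ e20; have [g [cg g01 ge]] := cB _ e20.
have cfg : continuous (fun x => Num.max (f x) (g x)).
  by move=> x; apply: (@continuous_max R R f g); [exact: cf|exact: cg].
exists (fun x => Num.max (f x) (g x)); split => //.
- move=> x; have /andP[f0 f1] := f01 x; have /andP[g0 g1] := g01 x.
  by rewrite le_max f0 /= ge_max f1.
- rewrite (splitr e); apply: err_le fe ge => //.
  + by apply: merr => //; exact: measurableU.
  + exact: merr.
  + exact: merr.
  move=> x; have /andP[f0 f1] := f01 x; have /andP[g0 g1] := g01 x.
  rewrite !indicE in_setU; case: (x \in A); case: (x \in B) => /=;
    rewrite ?subr0 ?(ler0_norm (_ : _ - 1 <= 0)) ?subr_le0 ?ge_max ?f1 ?g1//;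
    rewrite ?(ger0_norm f0) ?(ger0_norm g0) ?(ger0_norm (_ : 0 <= Num.max _ _)) ?le_max ?f0//;
    case: (leP (f x) (g x)) => fg; lra.
Qed.

(** A finite partial union misses only a set of small measure, by continuity from above of the
    finite measure [kappa]. *)
Let capprox_bigcup (F : (set R)^nat) : (forall k, measurable (F k)) ->
  (forall k, capprox (F k)) -> capprox (\bigcup_k F k).
Proof.
move=> mF cF.
have mS k : measurable (\big[setU/set0]_(i < k) F i) by exact: bigsetU_measurable.
have cS k : capprox (\big[setU/set0]_(i < k) F i).
  elim: k => [|k IH]; last by rewrite big_ord_recr/=; exact: (capproxU (mS k) (mF k) IH (cF k)).
  by rewrite big_ord0 -setCT; exact: capproxC capproxT.
have mU : measurable (\bigcup_k F k) by exact: bigcup_measurable.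
move=> e e0; have e20 : 0 < e / 2 by rewrite divr_gt0.
pose D k := \bigcup_k F k `\` \big[setU/set0]_(i < k) F i.
have mD k : measurable (D k) by exact: measurableD.
have [||k Dk] := @small_tail D _ e20 mD.
- apply/nonincreasing_seqP => k; apply/subsetPset.
  by apply: setDS; apply: subset_bigsetU.
- apply/seteqP; split => // x Dx.
  have [[i _ Fi] _] := Dx 0%N I.
  have [_] := Dx i.+1 I; apply.
  by rewrite -bigcup_mkord; exists i => //=.
have [h [ch h01 he]] := cS k _ e20.
exists h; split => //.
rewrite (splitr e).
have D0 : (\int[kappa]_x (\1_(D k) x)%:E <= (e / 2)%:E)%E.
  by rewrite integral_indic//; [rewrite setIT|exact: mD].
apply: (@err_le _ _ _ _ _ _ _ _ _ _ _ _ he D0) => //; do ?exact: merr.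
  by apply/measurable_EFinP; apply: measurable_indic; exact: mD.
move=> x; rewrite !indicE /D in_setD.
set S := \big[setU/set0]_(i < k) F i.
have [xS|xS] := boolP (x \in S).
  have -> : x \in \bigcup_k F k.
    by move: xS; rewrite !inE /S -bigcup_mkord => -[i _ Fi]; exists i.
  by rewrite addr0.
rewrite andbT subr0; have := ler_normB (h x) ((x \in \bigcup_k F k)%:R : R).
by rewrite normr_nat.
Qed.

Let capprox_ray (a : R) : capprox `]a, +oo[%classic.
Proof.
move=> e e0.
pose D (k : nat) := `]a, a + k.+1%:R^-1]%classic : set (measurableTypeR R).
have mD k : measurable (D k) by exact: measurable_itv.
have [||k Dk] := @small_tail D _ e0 mD.
- apply/nonincreasing_seqP => k; apply/subsetPset => x; rewrite /D /= !in_itv/=.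
  move=> /andP[-> /= xk]; rewrite (le_trans xk)// lerD2l lef_pV2 ?posrE ?ltr0n//.
  by rewrite ler_nat.
- apply/seteqP; split => // x Dx.
  have ax : a < x by have := Dx 0%N I; rewrite /D /= in_itv/= => /andP[].
  have [k kx] := ltr_add_invr ax.
  have := Dx k I; rewrite /D /= in_itv/= => /andP[_].
  by rewrite leNgt kx.
(* A ramp rising from 0 at a to 1 at a + 1/(k+1); it differs from the indicator only on [D k], and
   there by at most 1. *)
pose h (x : R) := Num.min 1 (Num.max 0 (k.+1%:R * (x - a))).
have ch : continuous h.
  move=> x; apply: (@continuous_min R R (fun=> 1) (fun x : R => Num.max 0 (k.+1%:R * (x - a)))); first exact: cvg_cst.
  apply: (@continuous_max R R (fun=> 0) (fun x : R => k.+1%:R * (x - a))); first exact: cvg_cst.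
  apply: cvgM; first exact: cvg_cst.
  by apply: cvgB; [exact: cvg_id|exact: cvg_cst].
have h01 x : 0 <= h x <= 1.
  by rewrite /h le_min ler01 le_max lexx ge_min lexx.
exists h; split => //.
have IE : (\int[kappa]_x (\1_(D k) x)%:E = kappa (D k))%E.
  by rewrite integral_indic// setIT.
apply: le_trans Dk; rewrite -IE.
apply: ge0_le_integral => //.
- exact: merr.
- by apply/measurable_EFinP; apply: measurable_indic; exact: mD.
move=> x _; rewrite lee_fin !indicE !mem_setE !in_itv/= andbT.
have k0 : 0 < k.+1%:R :> R by rewrite ltr0n.
have [ax|ax] := ltP a x; last first.
  rewrite subr0 /h max_l ?pmulr_rle0 ?subr_le0// min_r// normr0.
  by rewrite ler0n.
rewrite /=; have [xk|xk] := leP x (a + k.+1%:R^-1).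
  have /andP[h0 h1] := h01 x.
  by rewrite ler0_norm ?subr_le0// opprB lerBlDl lerDr.
have h1 : 1 <= Num.max 0 (k.+1%:R * (x - a)).
  rewrite le_max; apply/orP; right.
  by rewrite -(ler_pdivrMl _ _ k0) mulr1 lerBrDl ltW.
by rewrite /h (min_l h1) subrr normr0.
Qed.

(** Dynkin induction: open rays to the right form a generating class closed under intersection. *)
Lemma measurable_capprox (A : set R) : measurable A -> capprox A.
Proof.
move=> mA.
have GE := RGenOInfty.measurableE R.
refine (@dynkin_induction _ (measurableTypeR R) (@RGenOInfty.G R) capprox GE _ _ _ _ _ A _).
- move=> _ _ [a ->] [b ->]; exists (Num.max a b).
  by apply/seteqP; split => x /=; rewrite !in_itv/= !andbT gt_max => /andP.
- exact: capproxT.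
- by move=> _ [a ->]; exact: capprox_ray.
- by move=> S _; exact: capproxC.
- by move=> F mF _; exact: capprox_bigcup.
- have : (@RGenOInfty.G R).-sigma.-measurable A by rewrite -GE.
  exact.
Qed.

End continuous_approximation.

(** * Passing to Borel sets in the total variation distance *)

Section total_variation.
Variable R : realType.
Local Notation leb1 := (@lebesgue_measure R).
Local Notation gpdf := (@normal_pdf R 0 1).
Local Notation gauss := (@normal_prob R 0 1).

Lemma ge0_integral_mrestr d (T : measurableType d) (mu : {measure set T -> \bar R})
    (D : set T) (mD : measurable D) (f : T -> \bar R) :
  (forall x, 0 <= f x)%E -> measurable_fun setT f ->
  (\int[mrestr mu mD]_x f x = \int[mu]_(x in D) f x)%E.
Proof.
move=> f0 mf.
have N0 : mrestr mu mD (~` D) = 0%E by rewrite /mrestr setICl measure0.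
have mC : measurable (~` D) by exact: measurableC.
rewrite (ge0_negligible_integral mC measurableT mf _ N0)//.
rewrite setTD setCK; apply: eq_measure_integral => A mA AD.
by rewrite -[in RHS](setIidl AD).
Qed.

Lemma integral_gauss (f : R -> \bar R) :
  gauss.-integrable setT f ->
  (\int[gauss]_x f x = \int[leb1]_x (f x * (gpdf x)%:E))%E.
Proof.
move=> intf; have mf := measurable_int _ intf.
have dom := @normal_prob_dominates R 0 1.
rewrite -(Radon_Nikodym_change_of_variables dom)//.
have mpdf : measurable_fun setT (EFin \o gpdf).
  by apply/measurable_EFinP; exact: measurable_normal_pdf.
apply: ae_eq_integral => //.
- by apply: emeasurable_funM.
- exact: emeasurable_funM.
- apply: ae_eqe_mul2l; rewrite Radon_NikodymE.
  case: cid => /= g [g1 g2 g3].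
  by apply: integral_ae_eq => // E _ mE; rewrite -g3.
Qed.

Lemma tv_le_of_continuous d (T : measurableType d) (mu : {measure set T -> \bar R})
    (D : set T) (X : T -> R) (c : R) (A : set R) :
  measurable D -> (mu D < +oo)%E -> measurable_fun setT X -> measurable A ->
  (forall h : R -> R, continuous h -> (forall x, 0 <= h x <= 1) ->
    `|\int[mu]_(t in D) h (X t) - fine (mu D) * \int[leb1]_x (h x * gpdf x)| <= c) ->
  `|\int[mu]_(t in D) \1_A (X t) - fine (mu D) * fine (gauss A)| <= c.
Proof.
move=> mD finD mX mA H.
pose nu0 := mrestr mu mD : {measure set T -> \bar R}.
pose nu1 := pushforward nu0 (X : T -> measurableTypeR R) : {measure set _ -> \bar R}.
pose nu := nu1 mX.
(* The sum of the law of X on [D] and the Gaussian law: one and the same h is then close to the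
   indicator of A under both. *)
pose kappa := measure_add nu gauss : {measure set measurableTypeR R -> \bar R}.
set V := fine (mu D); have V0 : 0 <= V by exact: fine_ge0.
have V1 : 0 < 1 + V by rewrite ltr_pwDl.
have fin_kappa : (kappa setT < +oo)%E.
  have -> : kappa setT = (nu setT + gauss setT)%E by exact: measure_addE.
  rewrite lte_add_pinfty//; last by rewrite probability_setT ltry.
  by rewrite (_ : nu setT = mu D)// -[in RHS](setTI D).
apply/ler_addgt0Pr => e e0.
(* The Gaussian error J enters multiplied by V, and I + J <= e / (1 + V) gives I + V J <= e. *)
have d0 : 0 < e / (1 + V) by rewrite divr_gt0.
have [h [ch h01 he]] := measurable_capprox fin_kappa mA d0.
set dlt := e / (1 + V) in d0 he.
have mh : measurable_fun setT h by exact: continuous_measurable_fun.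
pose er x := `|h x - \1_A x|.
have er0 x : 0 <= er x by exact: normr_ge0.
have er1 x : er x <= 1.
  rewrite /er indicE; have /andP[h0 h1] := h01 x.
  by case: (x \in A) => /=; [rewrite ler0_norm ?subr_le0// opprB gerBl|rewrite subr0 ger0_norm].
have mer : measurable_fun setT er.
  by apply: measurableT_comp => //; apply: measurable_funB.
have merE : measurable_fun setT (EFin \o er) by exact/measurable_EFinP.
have bint (g : R -> R) : measurable_fun setT g -> (forall x, `|g x| <= 1) ->
    mu.-integrable D (EFin \o (fun t => g (X t))).
  move=> mg g1; apply: measurable_bounded_integrable => //.
    by apply: measurable_funTS; exact: measurableT_comp mg mX.
  exists 1; split; first exact: num_real.
  by move=> M M1 t _ /=; exact: (le_trans (g1 _) (ltW M1)).
have h1 x : `|h x| <= 1 by have /andP[? ?] := h01 x; rewrite ger0_norm.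
have mA1 : measurable_fun [set: R] (\1_A : R -> R).
  exact: measurable_indic.
have A1 x : `|(\1_A x : R)| <= 1.
  by rewrite indicE; case: (x \in A); rewrite ?normr1 ?normr0.
have er1' x : `|er x| <= 1 by rewrite ger0_norm.
have ig : gauss.-integrable [set: measurableTypeR R] (EFin \o er).
  apply: measurable_bounded_integrable => //.
  - by have := ltry (1 : R); rewrite -[X in (X < _)%E](probability_setT gauss).
  - exists 1; split; first exact: num_real.
    by move=> M M1 t _ /=; exact: (le_trans (er1' _) (ltW M1)).
move: he; rewrite ge0_integral_measure_add//=.
rewrite ge0_integral_pushforward//=.
rewrite preimage_setT ge0_integral_mrestr//; last exact: (measurableT_comp merE mX).
rewrite (integral_gauss ig).
under [X in (_ + X <= _)%E]eq_integral do rewrite -EFinM.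
have iI : (\int[mu]_(t in D) (er (X t))%:E)%E \is a fin_num.
  exact: (integrable_fin_num mD (bint er mer er1')).
have iJ : (\int[leb1]_x (er x * gpdf x)%:E)%E \is a fin_num.
  exact: (integrable_fin_num measurableT (@integrable_gpdf_mul R _ _ 1 measurableT mer er1')).
rewrite -(fineK iI) -(fineK iJ) -EFinD lee_fin -/(Rintegral _ _ _) -/(Rintegral leb1 _ _).
set I := Rintegral mu D _; set J := Rintegral leb1 _ _ => IJ.
have I0 : 0 <= I by apply: Rintegral_ge0.
have J0 : 0 <= J by apply: Rintegral_ge0 => x _; rewrite mulr_ge0// gpdf_ge0.
have gA : fine (gauss A) = \int[leb1]_x (\1_A x * gpdf x).
  rewrite /normal_prob -/(Rintegral leb1 A gpdf) Rintegral_mkcond.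
  apply: eq_Rintegral => x _; rewrite indicE /patch.
  by case: ifP => _; rewrite ?mul1r ?mul0r.
have ih := bint h mh h1; have iA := bint \1_A mA1 A1.
have jh := @integrable_gpdf_mul R setT h 1 measurableT mh h1.
have jA := @integrable_gpdf_mul R setT \1_A 1 measurableT mA1 A1.
have dI : `|\int[mu]_(t in D) h (X t) - \int[mu]_(t in D) \1_A (X t)| <= I.
  rewrite -RintegralB//; apply: le_normr_Rintegral => //.
  exact: (integrableB mD ih iA).
have dJ : `|\int[leb1]_x (h x * gpdf x) - \int[leb1]_x (\1_A x * gpdf x)| <= J.
  rewrite -RintegralB//; apply: le_trans (le_normr_Rintegral _ _) _ => //.
    exact: (integrableB measurableT jh jA).
  rewrite le_eqVlt; apply/orP; left; apply/eqP; apply: eq_Rintegral => x _.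
  by rewrite -mulrBl normrM (ger0_norm (gpdf_ge0 x)).
have := H h ch h01; rewrite -/V gA => Hh.
move: Hh dI dJ.
set a := Rintegral mu D (fun t => h (X t)); set b := Rintegral mu D (fun t => \1_A (X t)).
set p := Rintegral leb1 _ (fun x => h x * _); set q := Rintegral leb1 _ (fun x => \1_A x * _).
move=> Hh dI dJ.
have -> : b - V * q = (a - V * p) - (a - b) + V * (p - q) by ring.
rewrite (le_trans (ler_normD _ _))// normrM (ger0_norm V0).
have e1 : I + V * J <= e.
  have -> : e = (1 + V) * dlt by rewrite /dlt mulrCA mulfV ?mulr1// gt_eqF.
  have := ler_wpM2l V0 IJ; nra.
have := ler_wpM2l V0 dJ; have := ler_normB (a - V * p) (a - b).
lra.
Qed.

End total_variation.

(** * Traces and eigenvalues *)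

Section char_poly_square.
Variables (F : fieldType) (n : nat).
Implicit Types A B : 'M[F]_n.

(* det(X^2 - A^2) = det(X - A) det(X + A), and det(X + A) = (-1)^n det(-X - A). *)
Lemma char_poly_sqr_comp A : char_poly (A *m A) \Po 'X^2 =
  char_poly A * ((-1) ^+ n * (char_poly A \Po - 'X)).
Proof.
have cmx (q : {poly F}) B : char_poly B \Po q = \det (q%:M - map_mx polyC B).
  rewrite /char_poly -[LHS](det_map_mx (comp_poly q)); congr (\det _).
  apply/matrixP => i j; rewrite !mxE rmorphB rmorphMn /=.
  by rewrite comp_polyX comp_polyC.
rewrite !cmx [in X in X * _](_ : char_poly A = \det ('X%:M - map_mx polyC A))//.
rewrite -detZ -det_mulmx; congr (\det _).
rewrite scalerBr scale_scalar_mx mulN1r opprK scaleN1r opprK mulmxBl !mulmxDr.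
by rewrite map_mxM -scalar_mxM expr2 scalar_mxC opprD addrA addrK.
Qed.

(** Substituting X^2 for X is injective on polynomials, and the preceding factorization depends on
    the matrix only through its characteristic polynomial. *)
Lemma char_poly_sqr A B : char_poly A = char_poly B ->
  char_poly (A *m A) = char_poly (B *m B).
Proof.
move=> AB; apply/eqP; rewrite -subr_eq0 -(@comp_poly_eq0 _ _ 'X^2) ?size_polyXn//.
by rewrite rmorphB /= !char_poly_sqr_comp AB subrr.
Qed.

Lemma mxtrace_char_poly A B : char_poly A = char_poly B -> \tr A = \tr B.
Proof.
case: n A B => [|k] A B AB; first by rewrite /mxtrace !big_ord0.
by apply: oppr_inj; rewrite -!char_poly_trace// AB.
Qed.

End char_poly_square.

(** The eigenvalues are given only as roots of the characteristic polynomial. Instead of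
    diagonalizing A, compare it with the diagonal matrix D of these roots: equal characteristic
    polynomials stay equal after squaring, once and then twice, and they determine traces. *)
Lemma mxtrace_sqr_eigenvalues (F : fieldType) (n : nat) (A : 'M[F]_n) (d : 'I_n -> F) :
  char_poly A = \prod_(i < n) ('X - (d i)%:P) ->
  \tr (A *m A) = \sum_i d i ^+ 2 /\
  \tr ((A *m A) *m (A *m A)) = \sum_i d i ^+ 4.
Proof.
pose D := diag_mx (\row_i d i).
move=> cA; have cD : char_poly A = char_poly D.
  rewrite cA char_poly_trig ?diag_mx_is_trig//; apply: eq_bigr => i _.
  by rewrite !mxE eqxx mulr1n.
have D2 := char_poly_sqr cD; have D4 := char_poly_sqr D2.
rewrite (mxtrace_char_poly D2) (mxtrace_char_poly D4) !mulmx_diag !mxtrace_diag.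
by split; apply: eq_bigr => i _; rewrite !mxE -?expr2 -?exprM.
Qed.

(** * The total variation bound *)

Section sphere_expectation.
Variables (R : realType) (n : nat).

Lemma indic_pball (t : coords n) : \1_(@punct_ball R n) (vec t) = \1_(@pball R n) t :> R.
Proof. by rewrite !indicE; congr (_%:R); apply/idP/idP; rewrite !inE. Qed.

Lemma vol_pball : vol (@punct_ball R n) = lebn n (@pball R n).
Proof.
rewrite /vol iintE.
- rewrite (eq_integral (fun t => (\1_(@pball R n) t)%:E)); last first.
    by move=> t _; rewrite indic_pball.
  by rewrite integral_indic//; [rewrite setIT|exact: measurable_pball].
- by move=> x; rewrite lee_fin.
- rewrite (_ : (fun _ => _) = (fun t => (\1_(@pball R n) t)%:E)); last first.
    by apply/funext => t; rewrite indic_pball.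
  by apply/measurable_EFinP; apply: measurable_indic; exact: measurable_pball.
Qed.

Lemma sphere_expectE (phi : 'rV[R]_n -> R) : (forall x, 0 <= phi x) ->
  measurable_fun [set: coords n] (fun t => phi (normalize (vec t))) ->
  sphere_expect phi = (\int[lebn n]_(t in @pball R n) (phi (normalize (vec t)))%:E *
    (fine (lebn n (@pball R n)))^-1%:E)%E.
Proof.
move=> phi0 mphi; rewrite /sphere_expect vol_pball; congr (_ * _)%E.
rewrite iintE.
- rewrite [RHS]integral_mkcond; apply: eq_integral => t _.
  rewrite indic_pball indicE patchE.
  by case: ifP => _; rewrite ?mul1r ?mul0r.
- by move=> x; rewrite lee_fin mulr_ge0.
- apply/measurable_EFinP; apply: measurable_funM => //.
  rewrite (_ : (fun _ => _) = (\1_(@pball R n) : coords n -> R)); last first.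
    by apply/funext => t; rewrite indic_pball.
  by apply: measurable_indic; exact: measurable_pball.
Qed.

End sphere_expectation.

Definition stein_kernel (R : realType) (n : nat) (M : 'M[R]_n) (x : 'rV[R]_n) : R :=
  2 / n%:R * (qform (M *m M) x - qform M x ^+ 2).

(** * Moments of quadratic forms and the bound on E|1 - T| *)

Section moments.
Variables (R : realType) (n : nat).
Hypothesis n0 : (0 < n)%N.
Hypothesis volB : (lebn n (@pball R n) < +oo)%E.
Let V := fine (lebn n (@pball R n)).
Hypothesis V0 : 0 < V.

Let nR0 : (n%:R : R) != 0. Proof. by rewrite pnatr_eq0 -lt0n. Qed.

Let ccst (c : R) : continuous (fun _ : R => c).
Proof. by move=> x; exact: cvg_cst. Qed.

Lemma sint_qform (K : 'M[R]_n) : K^T = K -> n%:R * sint (qform K) = \tr K * V.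
Proof.
move=> symK.
have := @stein_identity R n K symK volB (fun=> 1) (fun=> 0)
  (fun x => is_derive_const x 1) (@ccst 0).
rewrite sint_cst mul1r.
rewrite (@eq_sint _ _ _ (qform K)); last by move=> x _; rewrite mulr1.
rewrite (@eq_sint _ _ (fun x => 0 * _) (fun=> 0)); last by move=> x _; rewrite mul0r.
by rewrite sint_cst mul0r mulr0 addr0.
Qed.

Lemma sint_qform_sqr (K : 'M[R]_n) : K^T = K ->
  (n%:R + 2) * sint (fun x => qform K x ^+ 2) =
  \tr K * sint (qform K) + 2 * sint (qform (K *m K)).
Proof.
move=> symK.
have := @stein_identity R n K symK volB id (fun=> 1)
  (fun x => is_derive_ident x) (@ccst 1).
rewrite (@eq_sint _ _ (fun x => 1 * _) (fun x => qform (K *m K) x - qform K x ^+ 2)); last first.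
  by move=> x _; rewrite mul1r.
rewrite sintB//; [|exact: sbdd_qform|by apply: sbddX; exact: sbdd_qform].
rewrite (@eq_sint _ _ (fun u => qform K u * _) (fun u => qform K u ^+ 2)); last first.
  by move=> x _; rewrite expr2.
by move=> H; rewrite mulrDl H; ring.
Qed.

Variable M : 'M[R]_n.
Hypothesis symM : M^T = M.
Hypothesis trM : \tr M = 0.
Hypothesis M1 : sint (fun x => qform M x ^+ 2) = V.

Let N := M *m M.
Let symN : N^T = N. Proof. by rewrite /N trmx_mul symM. Qed.

Let sint_qform_mulmx : sint (qform N) = (n%:R + 2) / 2 * V.
Proof.
have := sint_qform_sqr symM; rewrite trM mul0r add0r M1 -/N => H.
by apply: (mulfI (_ : (2 : R) != 0)); rewrite ?pnatr_eq0// -H; field.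
Qed.

Lemma mxtrace_mulmx_normalized : \tr N = n%:R * (n%:R + 2) / 2.
Proof.
have := sint_qform symN; rewrite sint_qform_mulmx => H.
by apply: (mulIf (lt0r_neq0 V0)); rewrite -H; field.
Qed.

Let nR : R := n%:R.
Let p := \tr (N *m N) / \tr N ^+ 2.

Let sint_qform_mulmx_sqr : sint (fun x => qform N x ^+ 2) = nR * (nR + 2) / 4 * (1 + 2 * p) * V.
Proof.
have n2 : nR + 2 != 0 by rewrite gt_eqF// ltr_wpDl.
have tr0 : \tr N != 0.
  by rewrite mxtrace_mulmx_normalized !mulf_neq0 ?invr_neq0// pnatr_eq0.
have H2 := sint_qform_sqr symN.
have symNN : (N *m N)^T = N *m N by rewrite trmx_mul symN.
have H4 := sint_qform symNN.
have NNE : \tr (N *m N) = p * (nR * (nR + 2) / 2) ^+ 2.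
  by rewrite /p -mxtrace_mulmx_normalized divfK// expf_neq0.
apply: (mulfI n2); rewrite H2 mxtrace_mulmx_normalized sint_qform_mulmx.
have -> : sint (qform (N *m N)) = \tr (N *m N) * V / n%:R.
  by rewrite -H4 mulrC mulKf.
by rewrite NNE /nR; field.
Qed.

Let sN : sbdd (qform N). Proof. exact: sbdd_qform. Qed.

Let T1 x := 2 / nR * qform N x.
Let a : R := 2 / nR.

(** The shift serves two uses: l = 0 gives the lower bound on p by positivity, l = s / 2 the upper
    bound on E|1 - T|. *)
Let sint_shift_sqr (l : R) : sint (fun x => (T1 x - 1 + l) ^+ 2) =
  ((1 + a) * (2 * p) - a + 2 * a * l + l ^+ 2) * V.
Proof.
rewrite (@eq_sint _ _ _ (fun x => (2 / nR) ^+ 2 * qform N x ^+ 2 +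
  2 * (2 / nR) * (l - 1) * qform N x + (l - 1) ^+ 2)); last first.
  by move=> x _; rewrite /T1; ring.
have s2 : sbdd (fun x => qform N x ^+ 2) by exact: sbddX.
rewrite sintD//; last exact: sbdd_cst; last first.
  by apply: sbddD; (apply: sbddM; first exact: sbdd_cst).
rewrite sintD//; [|by apply: sbddM => //; exact: sbdd_cst..].
rewrite (sintZ volB _ s2) (sintZ volB _ sN) sint_cst -/V sint_qform_mulmx sint_qform_mulmx_sqr /a /nR.
by field.
Qed.

(** With a = 2/n, positivity of E(T1 - 1)^2 = 2 (1 + a) p - a gives p >= a / (2 (1 + a)) =
    1/(n+2). *)
Lemma mxtrace_ratio_ge : 1 / (nR + 2) <= p.
Proof.
have n2 : 0 < nR + 2 by rewrite ltr_wpDl.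
have nR1 : 0 < nR by rewrite ltr0n.
have : 0 <= sint (fun x => (T1 x - 1 + 0) ^+ 2).
  by apply: sint_ge0 => x _; exact: sqr_ge0.
rewrite sint_shift_sqr pmulr_lge0// mulr0 expr0n/= !addr0 subr_ge0 => H.
rewrite ler_pdivrMr//.
have aE : a * nR = 2 by rewrite /a divfK.
nra.
Qed.

Let T := stein_kernel M.

Let sT : sbdd T.
Proof.
apply: sbddM; first exact: sbdd_cst.
by apply: sbddB => //; apply: sbddX; exact: sbdd_qform.
Qed.

Let sint_stein_kernel : sint T = V.
Proof.
rewrite sintZ//; last by apply: sbddB => //; apply: sbddX; exact: sbdd_qform.
rewrite sintB//; last by apply: sbddX; exact: sbdd_qform.
by rewrite sint_qform_mulmx M1 /nR; field.
Qed.

(* [T <= T1], and |T - 1| = 2 (T - 1)^+ - (T - 1) where T has mean 1. *)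
Lemma sint_stein_kernel_le (s : R) : (4 <= n)%N -> 0 < s -> s ^+ 2 = 6 * p ->
  sint (fun x => `|1 - stein_kernel M x|) <= s * V.
Proof.
move=> n4 s0 sE; rewrite -/T.
have nR4 : 4 <= nR by rewrite ler_nat.
have nR1 : 0 < nR by rewrite ltr0n.
pose l := s / 2; have l0 : 0 < l by rewrite divr_gt0.
have sT1 : sbdd (fun x => (T1 x - 1 + l) ^+ 2).
  apply: sbddX; apply: sbddD; last exact: sbdd_cst.
  apply: sbddB; last exact: sbdd_cst.
  by apply: sbddM => //; exact: sbdd_cst.
have sA : sbdd (fun x => s^-1 * (T1 x - 1 + l) ^+ 2) by apply: sbddM => //; exact: sbdd_cst.
have sB : sbdd (fun x => T x - 1) by apply: sbddB => //; exact: sbdd_cst.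
apply: (@le_trans _ _ (sint (fun x => s^-1 * (T1 x - 1 + l) ^+ 2 - (T x - 1)))).
  apply: le_sint => //.
  - by apply: sbdd_norm; apply: sbddB => //; exact: sbdd_cst.
  - exact: sbddB.
  - move=> x _.
    have TT1 : T x <= T1 x.
      by rewrite /T /stein_kernel /T1 ler_pM2l ?divr_gt0// gerBl sqr_ge0.
    have [T0|T0] := leP (T x) 1.
      rewrite ger0_norm ?subr_ge0//; apply: (@le_trans _ _ (0 - (T x - 1))).
        by rewrite sub0r opprB.
      by rewrite lerD2r mulr_ge0 ?invr_ge0 ?sqr_ge0// ltW.
    (* Since T <= T1 and s = 2 l, the claim reduces to 4 l x <= (x + l)^2 with x = T1 - 1. *)
    rewrite ltr0_norm ?subr_lt0// opprB lerBrDr mulrC ler_pdivlMr//.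
    have -> : s = 2 * l by rewrite /l; field.
    apply: (@le_trans _ _ (4 * l * (T1 x - 1))).
      have : l * T x <= l * T1 x by rewrite ler_pM2l.
      lra.
    rewrite -subr_ge0.
    have -> : (T1 x - 1 + l) ^+ 2 - 4 * l * (T1 x - 1) = (T1 x - 1 - l) ^+ 2 by ring.
    exact: sqr_ge0.
rewrite sintB// sintZ// sintB//; last exact: sbdd_cst.
rewrite sint_stein_kernel sint_cst -/V mul1r subrr subr0 sint_shift_sqr mulrA ler_pM2r//.
rewrite mulrC ler_pdivrMr// -expr2 sE.
(* The only place where n >= 4 matters: it says a = 2/n <= 1/2. *)
have a12 : a <= 1 / 2 by rewrite /a ler_pdivrMr//; lra.
have a0 : 0 < a by rewrite /a divr_gt0.
have p0 : 0 < p by rewrite -(pmulr_rgt0 _ (_ : 0 < 6)) -?sE ?exprn_gt0.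
(* This makes the cross term a s linear in p. The total to be compared with s^2 = 6 p is then at
   most 7 p / 2 + 5 a p - a / 2, and a <= 1/2 brings it below 7 p / 2 + 5 p / 2: the constant 6. *)
have s2 : 2 * s <= 6 * p + 1.
  rewrite -sE -subr_ge0 (_ : _ - _ = (s - 1) ^+ 2); last by ring.
  exact: sqr_ge0.
have l2 : l ^+ 2 = 3 / 2 * p.
  by rewrite /l expr_div_n sE; field.
rewrite l2.
have -> : 2 * a * l = a * s by rewrite /l; field.
have : a * (2 * s) <= a * (6 * p + 1) by rewrite ler_pM2l.
have : a * p <= 1 / 2 * p by rewrite ler_pM2r.
lra.
Qed.

(** The Stein equation evaluated at W replaces h(W) - E h(Z) by psi'(W) - W psi(W), and the identity
    on the sphere turns the last term into T psi'(W), the trace being 0. *)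
Lemma stein_bound (h : R -> R) : continuous h -> (forall x, 0 <= h x <= 1) ->
  `|sint (fun x => h (qform M x)) -
    V * \int[@lebesgue_measure R]_x (h x * normal_pdf 0 1 x)| <=
  sint (fun x => `|1 - stein_kernel M x|).
Proof.
move=> ch h01.
have [psi [dpsi [dE cd psiE d1]]] := stein_solution ch h01.
set m := Rintegral _ _ _ in psiE *.
have cpsi : continuous psi by move=> x; exact: is_derive_continuous (dE x).
have sM : sbdd (qform M) by exact: sbdd_qform.
have sd : sbdd (fun x => dpsi (qform M x)) by exact: sbdd_comp.
have sp : sbdd (fun x => qform M x * psi (qform M x)).
  by apply: sbddM => //; exact: sbdd_comp.
have sh : sbdd (fun x => h (qform M x)) by exact: sbdd_comp.
have sQ : sbdd (fun x => qform N x - qform M x ^+ 2).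
  by apply: sbddB => //; exact: sbddX.
have E : sint (fun x => h (qform M x)) - V * m =
    sint (fun x => dpsi (qform M x) * (1 - stein_kernel M x)).
  rewrite mulrC -sint_cst -sintB//; last exact: sbdd_cst.
  rewrite (@eq_sint _ _ _ (fun x => dpsi (qform M x) - qform M x * psi (qform M x))); last first.
    by move=> x _; rewrite psiE.
  rewrite sintB//.
  have := stein_identity symM volB dE cd; rewrite trM mul0r add0r => SI.
  have -> : sint (fun x => qform M x * psi (qform M x)) = 2 / nR *
      sint (fun x => dpsi (qform M x) * (qform N x - qform M x ^+ 2)).
    by apply: (mulfI nR0); rewrite SI /nR mulrA mulrCA mulfV// mulr1.
  rewrite -sintZ; [|exact: volB|exact: sbddM].
  rewrite -sintB//; last by apply: sbddM; [exact: sbdd_cst|exact: sbddM].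
  by apply: eq_sint => x _; rewrite /stein_kernel; ring.
rewrite E.
have s1T : sbdd (fun x => 1 - stein_kernel M x) by apply: sbddB => //; exact: sbdd_cst.
have sabs : sbdd (fun x => `|1 - stein_kernel M x|) by exact: sbdd_norm.
have bnd x : `|dpsi (qform M x) * (1 - stein_kernel M x)| <= `|1 - stein_kernel M x|.
  by rewrite normrM ler_piMl.
rewrite ler_norml; apply/andP; split.
- rewrite -mulN1r -sintZ//; apply: le_sint => //.
  + by apply: sbddM => //; exact: sbdd_cst.
  + exact: sbddM.
  + by move=> x _; have := bnd x; rewrite ler_norml mulN1r => /andP[].
- apply: le_sint => //; first exact: sbddM.
  by move=> x _; have := bnd x; rewrite ler_norml => /andP[].
Qed.

End moments.

(** * Normalization and conclusion *)

Lemma qform_scale (R : realType) (n : nat) (A : 'M[R]_n) (c : R) (x : 'rV[R]_n) :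
  qform (c *: A) x = c * qform A x.
Proof.
rewrite /qform mulr_sumr; apply: eq_bigr => i _; rewrite mulr_sumr.
by apply: eq_bigr => j _; rewrite mxE !mulrA.
Qed.

Lemma lpnormX (R : realType) (n k : nat) (d : 'I_n -> R) : (0 < k)%N -> ~~ odd k ->
  lpnorm k%:R d ^+ k = \sum_i d i ^+ k.
Proof.
move=> k0 ek; have k0' : (k%:R : R) != 0 by rewrite pnatr_eq0 -lt0n.
rewrite /lpnorm -powR_mulrn ?powR_ge0// -powRrM mulVf// powRr1; last first.
  by apply: sumr_ge0 => i _; exact: powR_ge0.
by apply: eq_bigr => i _; rewrite powR_mulrn// -normrX ger0_norm// exprn_even_ge0.
Qed.

Unset Implicit Arguments.

Theorem theorem3p3 (R : realType) (n : nat) (A : 'M[R]_n) (C : R)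
    (d : 'I_n -> R) :
  (2 <= n)%N ->
  A^T = A ->
  \tr A = 0 ->
  sphere_expect (fun x => (C * qform A x) ^+ 2) = 1%E ->
  char_poly A = \prod_(i < n) ('X - (d i)%:P) ->
  (dTV_sphere_gauss (fun x => (C * qform A x)%R)
     <= (Num.sqrt 6 * (lpnorm 4 d / lpnorm 2 d) ^+ 2)%:E)%E.
Proof.
move=> n2 symA trA E1 cA.
pose M := C *: A.
have ME : (fun x => C * qform A x) = qform M.
  by apply/funext => x; rewrite qform_scale.
have n0 : (0 < n)%N by exact: leq_trans n2.
have symM : M^T = M by rewrite /M linearZ/= symA.
have trM : \tr M = 0 by rewrite /M mxtraceZ trA mulr0.
have sM : sbdd (qform M) by exact: sbdd_qform.
have sM2 : sbdd (fun x => qform M x ^+ 2) by exact: sbddX.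
pose V := fine (lebn n (@pball R n)).
have E2 : (\int[lebn n]_(t in @pball R n) (qform M (normalize (vec t)) ^+ 2)%:E * V^-1%:E = 1)%E.
  rewrite -[RHS]E1 -(sphere_expectE (fun x => sqr_ge0 (qform M x)) sM2.1).
  by congr sphere_expect; rewrite -ME.
(* The volume is never computed. Were the ball null or of infinite measure, [fine] would make V
   equal to 0, its inverse 0, and the normalized second moment 0 instead of 1. *)
have VN0 : V != 0.
  apply/eqP => VE; move: E2; rewrite VE invr0 mule0 => /eqP.
  by rewrite eq_sym onee_eq0.
have V0 : 0 < V by rewrite lt_neqAle eq_sym VN0 fine_ge0.
have volB : (lebn n (@pball R n) < +oo)%E.
  by rewrite ltey; apply: contra VN0 => /eqP VE; rewrite /V VE.
have M1 : sint (fun x => qform M x ^+ 2) = V.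
  have fI := integrable_fin_num (measurable_pball R n) (sbdd_integrable1 volB sM2).
  move: E2; rewrite -(fineK fI) -EFinM => -[H].
  by apply: (mulIf (invr_neq0 VN0)); rewrite mulfV// -[RHS]H.
pose N := M *m M.
pose p := \tr (N *m N) / \tr N ^+ 2.
have [tr2 tr4] := mxtrace_sqr_eigenvalues cA.
have NE : N = C ^+ 2 *: (A *m A).
  by rewrite /N /M -scalemxAl -scalemxAr scalerA expr2.
have trN2 : \tr N = C ^+ 2 * \sum_i d i ^+ 2 by rewrite NE mxtraceZ tr2.
have trN4 : \tr (N *m N) = C ^+ 4 * \sum_i d i ^+ 4.
  by rewrite NE -scalemxAl -scalemxAr scalerA mxtraceZ tr4 -exprD.
have trN0 : \tr N != 0.
  have nR0 : (n%:R : R) != 0 by rewrite pnatr_eq0 -lt0n.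
  have nR2 : (n%:R + 2 : R) != 0 by rewrite gt_eqF// ltr_wpDl.
  by rewrite (mxtrace_mulmx_normalized volB V0 symM trM M1) !mulf_neq0// invr_neq0// pnatr_eq0.
have C0 : C != 0 by apply: contra trN0 => /eqP C0; rewrite trN2 C0 expr0n/= mul0r.
have d20 : \sum_i d i ^+ 2 != 0.
  by apply: contra trN0 => /eqP D0; rewrite trN2 D0 mulr0.
have pE : p = (\sum_i d i ^+ 4) / (\sum_i d i ^+ 2) ^+ 2.
  by rewrite /p trN4 trN2; field; rewrite C0 d20.
set s := Num.sqrt 6 * _.
have sE : s ^+ 2 = 6 * p.
  rewrite /s exprMn (sqr_sqrtr (ler0n R 6)) pE -exprM expr_div_n.
  by rewrite (@lpnormX R n 4 d isT isT) -(@lpnormX R n 2 d isT isT) -exprM.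
have p_gt0 : 0 < p.
  apply: lt_le_trans (mxtrace_ratio_ge n0 volB V0 symM trM M1).
  by rewrite divr_gt0// ltr_wpDl.
have s0 : 0 < s.
  have s2 : 0 < s ^+ 2 by rewrite sE mulr_gt0.
  rewrite lt_neqAle mulr_ge0 ?sqrtr_ge0 ?sqr_ge0// andbT eq_sym.
  by apply: contraTN s2 => /eqP ->; rewrite expr0n ltxx.
rewrite ME; apply: ub_ereal_sup => _ [B mB <-].
have mW : measurable_fun [set: coords n] (fun t => qform M (normalize (vec t))) := sM.1.
pose b (x : 'rV[R]_n) : R := \1_B (qform M x).
have bE : (fun x => \1_[set x | qform M x \in B] x) = b.
  by apply/funext => x; rewrite /b !indicE; congr (_%:R); rewrite mem_setE.
have b01 x : 0 <= b x <= 1 by rewrite /b indicE; case: (_ \in B); rewrite ?lexx ?ler01.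
have sb : sbdd b.
  split; first exact: (measurableT_comp (measurable_indic mB) mW).
  by exists 1 => x _; have /andP[? ?] := b01 x; rewrite ger0_norm.
have fb := integrable_fin_num (measurable_pball R n) (sbdd_integrable1 volB sb).
have fg : normal_prob 0 1 B \is a fin_num by exact: fin_num_measure.
rewrite /sphere_prob bE sphere_expectE; last 2 first.
- by move=> x; have /andP[] := b01 x.
- exact: sb.1.
rewrite -(fineK fb) -(fineK fg) -EFinM -EFinB -/(Rintegral _ _ _) -/V lee_fin.
rewrite -/(sint b); set g := fine _.
have g0 : 0 <= g by exact: fine_ge0.
have g1 : g <= 1 by rewrite -lee_fin fineK// probability_le1.
have -> : sint b / V - g = (sint b - V * g) / V by rewrite mulrBl mulrAC divff// mul1r.
rewrite normrM (gtr0_norm (_ : 0 < V^-1)) ?invr_gt0// ler_pdivrMr//.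
have [n4|n4] := leqP 4 n.
  apply: tv_le_of_continuous => //; first exact: measurable_pball.
  move=> h ch h01; apply: le_trans (stein_bound n0 volB symM trM ch h01) _.
  exact: (sint_stein_kernel_le n0 volB V0 symM trM M1).
(* For n <= 3, p >= 1/(n+2) >= 1/5, so s^2 = 6 p >= 6/5, whereas two probabilities differ by at most
   1. *)
have s1 : 1 <= s.
  rewrite -(@ler_pXn2r _ 2) ?nnegrE ?ler01 ?(ltW s0)// expr1n sE.
  have pge : 1 / (n%:R + 2) <= p := mxtrace_ratio_ge n0 volB V0 symM trM M1.
  have n3 : (n%:R : R) <= 3 by rewrite (ler_nat _ n 3).
  rewrite -ler_pdivrMl// mulr1; apply: le_trans pge.
  by rewrite div1r lef_pV2 ?posrE ?ltr_wpDl//; lra.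
have I0 : 0 <= sint b by apply: sint_ge0 => x _; have /andP[] := b01 x.
have I1 : sint b <= V.
  rewrite -[V]mul1r -sint_cst; apply: le_sint => //; first exact: sbdd_cst.
  by move=> x _; have /andP[] := b01 x.
have Vg : V * g <= V by rewrite ler_piMr// ltW.
have Vg0 : 0 <= V * g by rewrite mulr_ge0// ltW.
have sV : V <= s * V by rewrite ler_peMl// ltW.
rewrite ler_norml; apply/andP; split; lra.
Qed.
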